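(* Let $K$ be a number field, $q,\xi,\alpha_1,\dots,\alpha_m\in K^*$, $\beta_0,\dots,\beta_m\in K$. Assume that for no archimedean place $v$ of $K$ is $|q|_v=1$, and that the classes of $\alpha_1,\dots,\alpha_m$ in $K^*/q^{\mathbb{Z}}$ are pairwise distinct. If for every place $v$ of $K$ with $|q|_v>1$ the $v$-adic function $\beta_0+\beta_1E_q(\alpha_1z)+\dots+\beta_mE_q(\alpha_mz)$ vanishes at $z=\xi$, then $\beta_0=\beta_1E_q(\alpha_1\xi)=\dots=\beta_mE_q(\alpha_m\xi)=0$.
   Context: $n_q=\frac{1-q^n}{1-q}$, $n_q!=\prod_{k=1}^nk_q$, and $E_q(z)=\sum_{n\ge0}\frac{z^n}{n_q!}$ (the $q$-exponential); at a place $v$ with $|q|_v>1$ this series converges on all of $\mathbb{C}_v$, where it equals $\prod_{m\ge1}\bigl(1+(q-1)z/q^m\bigr)$. *)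

(* Defs.v *)
From HB Require Import structures.
From mathcomp Require Import all_boot all_order all_algebra all_field.
From mathcomp Require Import all_classical all_reals all_analysis.
Set Implicit Arguments. Unset Strict Implicit. Unset Printing Implicit Defensive.
Import Order.TTheory GRing.Theory Num.Theory.
Local Open Scope ring_scope.

(* A (nontrivial) absolute value on a field K with values in a real field R.
   Places of K are equivalence classes of such absolute values; every class
   contains a representative satisfying the triangle inequality. *)
Definition is_absval (K : fieldType) (R : realType) (f : K -> R) : Prop :=
  [/\ f 0 = 0,
      (forall x : K, x != 0 -> 0 < f x),
      (forall x y : K, f (x * y) = f x * f y),
      (forall x y : K, f (x + y) <= f x + f y)
    & exists x : K, x != 0 /\ f x != 1].

Definition ultrametric_absval (K : fieldType) (R : realType) (f : K -> R) : Prop :=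
  forall x y : K, f (x + y) <= Num.max (f x) (f y).

Definition qnum (K : fieldType) (q : K) (n : nat) : K :=
  (1 - q ^+ n) / (1 - q).

Definition qfact (K : fieldType) (q : K) (n : nat) : K :=
  \prod_(1 <= k < n.+1) qnum q k.

Definition Eq_partial (K : fieldType) (q z : K) (N : nat) : K :=
  \sum_(n < N) z ^+ n / qfact q n.

(* Main.v *)
Require Import Defs.
From mathcomp Require Import all_boot all_order all_algebra all_field.
From mathcomp Require Import all_classical all_reals all_analysis.
From mathcomp Require Import complex spectral perm.
From mathcomp Require Import ring lra zify.
Set Implicit Arguments. Unset Strict Implicit. Unset Printing Implicit Defensive.
Import Order.TTheory GRing.Theory Num.Theory.
Import numFieldNormedType.Exports.
Local Open Scope ring_scope.

(** Let [S N] be the partial sums of [beta0 + \sum_i beta i * E_q (x i)],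
    [x i = alpha i * xi], and let [u n = n_q! * S (n + 1)], so that
    [u (n+1) = (n+1)_q * u n + \sum_i beta i * x i ^ (n+1)].  At a place with
    [|q| <= 1] the sequence [u] grows at most geometrically.  At a place with
    [|q| > 1] this also holds because [S N] tends to [0], and iterating the
    recurrence produces, for each [k], a fixed linear combination of shifts of
    [u] of size [O (C^n |q|^(-k n))].  Hence the [N x N] Hankel determinant of
    [u] is smaller than [|q|^(- M N^2)] for every [M] at those places, and the
    product formula, applied to [D^(2 N^2) q^(M N^2)] times the determinant,
    forces it to vanish for large [N].  By Kronecker's criterion [u] is then
    linearly recurrent, and comparing its characteristic roots with the
    recurrence leaves only [x i = q^t / (1 - q)] with [t >= 1] when
    [beta i <> 0]: these are zeros of [E_q].

    The only places needed in the product formula are the complex embeddings,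
    read off a simultaneous triangularization of the regular representation, and
    p-adic absolute values with bounded ramification, built from maximal
    subrings avoiding a given element. *)

(** * Polynomials acting on sequences through the shift operator *)

Section ShiftAction.
Variable F : fieldType.
Implicit Types (p r : {poly F}) (u v : nat -> F).

Definition act p u n := \sum_(i < size p) p`_i * u (i + n)%N.

Definition kills p u := forall n, act p u n = 0.

(** This is $p(cX)$. Conjugating the shift by the twist $u_k \mapsto c^k u_k$ multiplies it by $c$,
    which is how this operation enters [act_twist]. *)
Definition dilate (c : F) p := \poly_(i < size p) (p`_i * c ^+ i).

Lemma act_widen p u n k : (size p <= k)%N ->
  act p u n = \sum_(i < k) p`_i * u (i + n)%N.
Proof.
move=> le; rewrite /act (big_ord_widen _ (fun i => p`_i * u (i + n)%N) le).
rewrite [RHS](bigID (fun i : 'I_k => (i < size p)%N)) /= [X in _ + X]big1 ?addr0 //.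
by move=> i; rewrite -leqNgt => /leq_sizeP/(_ _ (leqnn _)) ->; rewrite mul0r.
Qed.

Lemma actD p r u n : act (p + r) u n = act p u n + act r u n.
Proof.
pose k := maxn (size p) (size r).
rewrite !(@act_widen _ _ _ k) ?leq_maxl ?leq_maxr ?size_polyD // -big_split /=.
by apply: eq_bigr => i _; rewrite coefD mulrDl.
Qed.

Lemma actZ c p u n : act (c *: p) u n = c * act p u n.
Proof.
rewrite (@act_widen _ _ _ (size p)) ?size_scale_leq // mulr_sumr.
by apply: eq_bigr => i _; rewrite coefZ mulrA.
Qed.

Lemma act0p u n : act 0 u n = 0.
Proof. by rewrite /act size_poly0 big_ord0. Qed.

Lemma actC c u n : act c%:P u n = c * u n.
Proof.
by rewrite (@act_widen _ _ _ 1) ?size_polyC_leq1 // big_ord1 coefC /= add0n.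
Qed.

Lemma actMX p u n : act (p * 'X) u n = act p u n.+1.
Proof.
rewrite (@act_widen _ _ _ (size p).+1); last first.
  by apply: leq_trans (size_polyMleq _ _) _; rewrite size_polyX addnS addn1.
rewrite big_ord_recl coefMX /= mul0r add0r; apply: eq_bigr => i _.
by rewrite coefMX /= addnS /bump /= addSn.
Qed.

Lemma actM p r u n : act (p * r) u n = act p (act r u) n.
Proof.
elim/poly_ind: p n => [|p c IH] n; first by rewrite mul0r !act0p.
rewrite mulrDl !actD actMX -mulrA -commr_polyX mulrA actMX IH.
by rewrite mul_polyC actZ actC.
Qed.

Lemma act_ext p u v n : u =1 v -> act p u n = act p v n.
Proof. by move=> e; apply: eq_bigr => i _; rewrite e. Qed.

Lemma act_add p u v n : act p (fun k => u k + v k) n = act p u n + act p v n.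
Proof. by rewrite -big_split; apply: eq_bigr => i _; rewrite mulrDr. Qed.

Lemma act_mul p c u n : act p (fun k => c * u k) n = c * act p u n.
Proof. by rewrite mulr_sumr; apply: eq_bigr => i _; rewrite mulrCA. Qed.

Lemma act_sum (I : finType) (P : pred I) p (v : I -> nat -> F) n :
  act p (fun k => \sum_(i | P i) v i k) n = \sum_(i | P i) act p (v i) n.
Proof. by rewrite exchange_big; apply: eq_bigr => i _; rewrite mulr_sumr. Qed.

Lemma act_geometric p x n : act p (fun k => x ^+ k) n = p.[x] * x ^+ n.
Proof.
rewrite horner_coef mulr_suml; apply: eq_bigr => i _.
by rewrite exprD mulrA.
Qed.

Lemma coef_dilate c p i : (dilate c p)`_i = p`_i * c ^+ i.
Proof.
rewrite coef_poly; case: ltnP => // /leq_sizeP/(_ _ (leqnn _)) ->.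
by rewrite mul0r.
Qed.

Lemma size_dilate c p : c != 0 -> size (dilate c p) = size p.
Proof.
move=> c0; apply/eqP; rewrite eqn_leq size_poly /=.
apply/leq_sizeP => j /leq_sizeP/(_ _ (leqnn _)).
by rewrite coef_dilate => /eqP; rewrite mulf_eq0 expf_eq0 (negPf c0) andbF orbF => /eqP.
Qed.

Lemma dilate_eq0 c p : c != 0 -> (dilate c p == 0) = (p == 0).
Proof. by move=> c0; rewrite -!size_poly_eq0 size_dilate. Qed.

Lemma horner_dilate c p x : (dilate c p).[x] = p.[c * x].
Proof.
rewrite (@horner_coef_wide _ (size p)) ?size_poly // horner_coef.
by apply: eq_bigr => i _; rewrite coef_dilate exprMn mulrA.
Qed.

Lemma act_twist c p u n :
  act p (fun k => c ^+ k * u k) n = c ^+ n * act (dilate c p) u n.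
Proof.
rewrite (@act_widen (dilate c p) _ _ (size p)) ?size_poly // mulr_sumr.
by apply: eq_bigr => i _; rewrite coef_dilate exprD; ring.
Qed.

Lemma kills_mull p r u : kills r u -> kills (p * r) u.
Proof.
move=> h n; rewrite actM (act_ext _ _ (h : act r u =1 fun=> 0)).
by rewrite /act big1 // => i _; rewrite mulr0.
Qed.

Lemma kills_mulr p r u : kills r u -> kills (r * p) u.
Proof. by rewrite mulrC; apply: kills_mull. Qed.

Lemma kills_twist c p u : c != 0 ->
  kills p (fun k => c ^+ k * u k) <-> kills (dilate c p) u.
Proof.
move=> c0; split => h n.
  by apply: (mulfI (expf_neq0 n c0)); rewrite -act_twist h mulr0.
by rewrite act_twist h mulr0.
Qed.

(** The annihilators of [u] form an ideal; by Euclidean division a nonzero one of least size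
    generates it. *)
Lemma minimal_annihilator u r0 : r0 != 0 -> kills r0 u ->
  exists r, [/\ r != 0, kills r u & forall p, kills p u -> r %| p].
Proof.
move=> r00 k0.
have ex : exists n, `[< exists r, [/\ r != 0, kills r u & size r = n] >].
  by exists (size r0); apply/asboolP; exists r0.
case: (ex_minnP ex) => n /asboolP[r [rn0 kr sr]] mn.
exists r; split => // p kp; apply/eqP; apply/eqP/contraT => nz.
have km : kills (p %% r) u.
  move=> k; move: (kp k); rewrite {1}(divp_eq p r) actD kills_mull // add0r.
  by [].
have := mn (size (p %% r)); rewrite leqNgt -sr ltn_modp rn0 => /(_ _)/negP.
by case=> //; apply/asboolP; exists (p %% r).
Qed.

End ShiftAction.

(** * Hankel determinants and linear recurrence *)

Section Kronecker.
Variables (F : fieldType) (u : nat -> F).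

Definition hankel N : 'M[F]_N := \matrix_(i, j) u (i + j).

(** The linear functional $X^n \mapsto u_n$; the Hankel matrix is the Gram matrix of $(a, b) \mapsto
    \ell(ab)$ on monomials. *)
Let ell (p : {poly F}) := act p u 0.

Let ellMXn p n : ell (p * 'X^n) = act p u n.
Proof.
rewrite /ell; elim: n p => [|n IH] p; first by rewrite mulr1.
by rewrite exprS mulrA IH actMX.
Qed.

Let ell_mul (p b : {poly F}) N : (size b <= N)%N -> (forall i, (i < N)%N -> act p u i = 0) ->
  ell (p * b) = 0.
Proof.
move=> sb h; rewrite mulrC /ell actM (act_widen _ _ sb) big1 // => i _.
by rewrite addn0 h ?mulr0.
Qed.

(** A row vector of the left kernel is read as the coefficients of a polynomial [a]; its product
    with column [i] is [act a u i]. *)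
Lemma hankel_eq0P N : reflect
  (exists a : {poly F}, [/\ a != 0, (size a <= N)%N &
     forall i, (i < N)%N -> act a u i = 0])
  (\det (hankel N) == 0).
Proof.
have hE (v : 'rV[F]_N) (i : 'I_N) : (v *m hankel N) 0 i = act (rVpoly v) u i.
  rewrite (@act_widen _ _ _ _ N) ?size_poly // mxE; apply: eq_bigr => j _.
  by rewrite coef_rVpoly_ord mxE.
apply: (iffP idP) => [/det0P[v v0 hv]|[a [a0 sa ha]]].
  exists (rVpoly v); split.
  - by apply: contraNneq v0 => e; rewrite -[v]rVpolyK e linear0.
  - exact: size_poly.
  - by move=> i iN; rewrite -(hE v (Ordinal iN)) hv mxE.
apply/det0P; exists (poly_rV a : 'rV_N).
  by apply: contraNneq a0 => e; rewrite -(poly_rV_K sa) e linear0.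
apply/rowP => i; rewrite hE poly_rV_K // mxE; exact: ha.
Qed.

(** Take the largest [p] with nonsingular $p \times p$ Hankel matrix and a kernel polynomial [P] for
    size [p.+1]. By strong induction, a kernel polynomial of size [m.+1] is a multiple of [P], and
    this yields $\ell(P X^m) = 0$. *)
Theorem kronecker N0 : (forall N, (N0 <= N)%N -> \det (hankel N) = 0) ->
  exists r, r != 0 /\ kills r u.
Proof.
move=> h0.
have [p [hp hmax]] : exists p, \det (hankel p) != 0 /\
    forall N, (p < N)%N -> \det (hankel N) = 0.
  have ex : exists n, \det (hankel n) != 0.
    by exists 0%N; rewrite det_mx00 oner_neq0.
  have bd n : \det (hankel n) != 0 -> (n <= N0)%N.
    by apply: contraNT; rewrite -ltnNge => /ltnW/h0/eqP.
  case: (ex_maxnP ex bd) => p hp mx; exists p; split => // N pN.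
  by apply/eqP; apply: contraTT pN => /mx; rewrite -leqNgt.
have inj (a : {poly F}) : (size a <= p)%N -> (forall i, (i < p)%N -> act a u i = 0) -> a = 0.
  move=> sa ha; apply/eqP; apply: contraNT hp => a0.
  by apply/hankel_eq0P; exists a.
have /eqP/hankel_eq0P[P [P0 sP hP]] := hmax p.+1 (leqnn _).
exists P; split => // m.
elim/ltn_ind: m => m IH.
case: (ltnP m p.+1) => [/hP //|pm].
have /eqP/hankel_eq0P[a [a0 sa ha]] := hmax m.+1 (leqW pm).
have szP : size P = p.+1.
  apply/eqP; rewrite eqn_leq sP ltnNge; apply: contra P0 => sP'.
  by apply/eqP/inj => // i ip; apply: hP; apply: ltnW.
have sd : (size (a %/ P)%R <= m.+1 - p)%N.
  by rewrite size_divp // szP /= leq_sub2r.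
(* For [i < p], both [a] and its part divisible by [P] annihilate [u] at [i], so the remainder, of
   size at most [p], lies in the kernel of a nonsingular matrix. *)
have rho0 : a %% P = 0.
  apply: inj; first by have := ltn_modp a P; rewrite P0 szP.
  move=> i ip; have := ha i (ltn_trans ip (leqW pm)).
  rewrite {1}(divp_eq a P) actD -[X in X + _]ellMXn [_ * P]mulrC -mulrA.
  rewrite (@ell_mul _ _ m) ?add0r //.
  apply: leq_trans (size_polyMleq _ _) _; rewrite size_polyXn addnS /=.
  by apply: leq_trans (leq_add sd (leqnn _)) _; move: ip pm; lia.
have aE : a = P * (a %/ P) by rewrite {1}(divp_eq a P) rho0 addr0 mulrC.
set Q := a %/ P in sd aE.
have Q0 : Q != 0 by apply: contraNneq a0 => e; rewrite aE e mulr0.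
have sQ : (0 < size Q)%N by rewrite size_poly_gt0.
(* With this index $B = Q X^{m+1-\mathrm{size}\,Q}$ has degree exactly [m]; by induction only its
   top coefficient contributes to $\ell(PB) = 0$, leaving [lead_coef Q] times [act P u m]. *)
have := ha (m.+1 - size Q)%N; rewrite ltn_subrL sQ => /(_ isT).
rewrite -ellMXn aE -mulrA.
set B := Q * _.
have sB : size B = m.+1.
  by rewrite /B size_mulXn // subnK // (leq_trans sd) ?leq_subr.
have Bm : B`_m = lead_coef Q.
  rewrite /B coefMXn /lead_coef; case: ltnP => [|_].
    by case: (size Q) sQ => // k _; lia.
  congr (_`_ _); have := leq_trans sd (leq_subr _ _).
  by case: (size Q) sQ => // k _; lia.
rewrite mulrC /ell actM /act sB big_ord_recr /= big1 ?add0r.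
  rewrite Bm addn0 => /eqP; rewrite mulf_eq0 lead_coef_eq0 (negPf Q0) /=.
  by move/eqP.
by move=> i _; rewrite addn0 -/(act P u i) IH ?mulr0.
Qed.

End Kronecker.

(** * Characteristic roots of a recurrent solution *)

Section Classification.
Variables (F : fieldType) (q c : F) (m : nat) (b x : 'I_m -> F) (u : nat -> F).
Hypotheses (q0 : q != 0) (c0 : c != 0).
Hypothesis qX : forall k, q ^+ k.+1 != 1.
Hypothesis x0 : forall i, x i != 0.
Hypothesis xq : forall (i j : 'I_m) (k : int), i != j -> x i != x j * q ^ k.
Hypothesis rec : forall n,
  u n.+1 = c * (1 - q ^+ n.+1) * u n + \sum_i b i * x i ^+ n.+1.

Let forcing n := \sum_(i | b i != 0) b i * x i * x i ^+ n.
Let twisted n := q ^+ n * u n.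
Let P := \prod_(i | b i != 0) ('X - (x i)%:P).

Let recE n : u n.+1 = c * u n + - (c * q) * twisted n + forcing n.
Proof.
rewrite rec /twisted /forcing; congr (_ + _); first by rewrite exprS; ring.
rewrite (bigID (fun i => b i != 0)) /= [X in _ + X]big1 ?addr0.
  by apply: eq_bigr => i _; rewrite exprS mulrA.
by move=> i; rewrite negbK => /eqP ->; rewrite mul0r.
Qed.

Let act_forcing p n :
  act p forcing n = \sum_(i | b i != 0) b i * x i * p.[x i] * x i ^+ n.
Proof.
rewrite act_sum; apply: eq_bigr => i _.
by rewrite (act_mul p (b i * x i) (fun k => x i ^+ k)) act_geometric !mulrA.
Qed.

Let kills_forcing : kills P forcing.
Proof.
move=> n; rewrite act_forcing big1 // => i bi.
by rewrite /P horner_prod (bigD1 i) //= hornerXsubC subrr mul0r mulr0 mul0r.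
Qed.

Let x_inj i j : i != j -> x i != x j.
Proof. by move=> ij; have := xq 0 ij; rewrite expr0z mulr1. Qed.

(** Multiplying [p] by [L], which vanishes at every other [x j] in play, isolates one geometric
    term; its coefficient $b_i x_i L(x_i) p(x_i)$ must vanish. *)
Let killed_forcing p i : kills p forcing -> b i != 0 -> root p (x i).
Proof.
move=> kp bi.
pose L := \prod_(j | (b j != 0) && (j != i)) ('X - (x j)%:P).
have := kills_mull L kp 0; rewrite act_forcing (bigD1 i) //= big1 ?addr0.
  rewrite expr0 mulr1 hornerM mulrA => /eqP; rewrite !mulf_eq0 (negPf bi).
  rewrite (negPf (x0 i)) /= => /orP[|//].
  rewrite /L horner_prod => /prodf_eq0[j /andP[_ ji]].
  by rewrite hornerXsubC subr_eq0 eq_sym (negPf (x_inj ji)).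
move=> j /andP[bj ji].
by rewrite hornerM /L horner_prod (bigD1 j) ?bj //= hornerXsubC subrr !(mul0r, mulr0).
Qed.

Let rootP_in s : root P s -> exists2 i, b i != 0 & s = x i.
Proof.
rewrite /root /P horner_prod => /prodf_eq0[i bi].
by rewrite hornerXsubC subr_eq0 => /eqP ->; exists i.
Qed.

Let qz_inj (s : F) : s != 0 -> injective (fun k : nat => s * q ^+ k).
Proof.
move=> s0 k l /(mulfI s0).
wlog kl : k l / (k <= l)%N.
  by move=> W e; case: (leqP k l) => [|/ltnW] h; [|symmetry]; apply: W.
move: kl => /subnK <-; case: (l - k)%N => // d; rewrite exprD -{1}[q ^+ k]mul1r.
by move/(mulIf (expf_neq0 k q0)) => e; have := qX d; rewrite -e eqxx.
Qed.

Let finite_roots (r : {poly F}) (z : nat -> F) : r != 0 -> injective z ->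
  ~ (forall k, root r (z k)).
Proof.
move=> r0 zi h.
have := @max_poly_roots _ r [seq z k | k <- iota 0 (size r)] r0.
rewrite size_map size_iota map_inj_uniq // iota_uniq ltnn => /(_ _ isT) W.
by suff: false by []; apply: W; apply/allP => _ /mapP[k _ ->].
Qed.

(* Writing [Z] for the roots of the minimal annihilator of [u], the recurrence
   shows [q Z] is contained in [Z] and the [x i], [Z \ {c}] in [q Z] and the
   [x i], and each [x i] lies in [Z] or [q Z]; finiteness of [Z] then forces a
   downward [q]-chain from [x i] to end at [c]. *)
Lemma frequencies_of_recurrent (r0 : {poly F}) : r0 != 0 -> kills r0 u ->
  forall i, b i != 0 -> exists t, x i = c * q ^+ t.+1.
Proof.
move=> r00 /(minimal_annihilator r00)[r [rn0 kr rmin]] i bi.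
pose r' := dilate q^-1 r.
have kr' : kills r' twisted.
  apply/kills_twist => // n.
  have -> : dilate q r' = r; last exact: kr.
  by apply/polyP => k; rewrite !coef_dilate -mulrA -exprMn mulVf // expr1n mulr1.
have cq0 : - (c * q) != 0 by rewrite oppr_eq0 mulf_neq0.
have actXc p n : act (p * ('X - c%:P)) u n =
    - (c * q) * act p twisted n + act p forcing n.
  rewrite actM -act_mul -act_add; apply: act_ext => k.
  rewrite -polyCN actD actC -['X]mul1r actMX -[1]/(1%:P) actC mul1r recE; ring.
(* Since [r * P * ('X - c%:P)] kills [u], [r * P] kills [twisted], so [r] divides $(rP)(qX)$;
   evaluate at [l]. *)
have up l : root r l -> root r (q * l) \/ exists2 j, b j != 0 & q * l = x j.
  move=> rl.
  have kT : kills (r * P) twisted.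
    move=> n; apply: (mulfI cq0); rewrite mulr0.
    have := actXc (r * P) n; rewrite (kills_mull _ kills_forcing) addr0 => <-.
    by rewrite mulrC; apply: kills_mull; apply: kills_mulr.
  have /dvdpP[w] := rmin _ ((kills_twist _ _ q0).1 kT).
  move/(congr1 (fun p => p.[l])); rewrite horner_dilate !hornerM.
  move/eqP: rl => ->; rewrite mulr0 => /eqP; rewrite mulf_eq0 => /orP[]; first by left.
  by move/rootP_in; right.
(* Here [r' * P] kills both [twisted] and [forcing], so [r] divides $r(X/q)\,P\,(X - c)$. *)
have down l : root r l ->
    [\/ l = c, root r (l / q) | exists2 j, b j != 0 & l = x j].
  move=> rl.
  have kk : kills (r' * P * ('X - c%:P)) u.
    move=> n; rewrite actXc (kills_mull _ kills_forcing) addr0.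
    by rewrite (kills_mulr P kr') mulr0.
  have /dvdpP[w] := rmin _ kk.
  move/(congr1 (fun p => p.[l])); rewrite !hornerM hornerXsubC horner_dilate.
  move/eqP: rl => ->; rewrite mulr0 => /eqP; rewrite !mulf_eq0 subr_eq0.
  case/orP => [/orP[h|/rootP_in h]|/eqP h]; [|by apply: Or33|by apply: Or31].
  by apply: Or32; rewrite mulrC.
(* As [r] kills [u] and [r'] kills [twisted], the product [r * r'] kills [forcing]. *)
have start : root r (x i) \/ root r (x i / q).
  have kf : kills (r * r') forcing.
    move=> n; have := actXc (r * r') n.
    rewrite (kills_mull _ kr') mulr0 add0r => <-.
    by rewrite -mulrA mulrC; apply: kills_mull.
  have := killed_forcing kf bi; rewrite rootM => /orP[]; first by left.
  by right; rewrite /root mulrC -horner_dilate.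
have orbit (k : int) : forall j, x i * q ^ k = x j -> j = i.
  move=> j e; apply/eqP; apply: contraT => ji; have := xq k ji.
  by rewrite e eqxx.
have orbit0 (k : nat) : x i * q ^+ k.+1 <> x i.
  by move=> e; have := @qz_inj _ (x0 i) k.+1 0%N; rewrite /= expr0 mulr1 => /(_ e).
(* Otherwise [up] puts the whole ray $x_i q^k$ among the roots: another [x j] is never met because
   the classes are distinct, nor [x i] again because [q] is not a root of unity. *)
have nZ : ~ root r (x i).
  move=> h; apply: (@finite_roots r (fun k => x i * q ^+ k)) => //.
    exact: qz_inj.
  elim=> [|k IH]; first by rewrite mulr1.
  have [|[j _]] := up _ IH; first by rewrite exprS mulrCA.
  rewrite mulrCA -exprS => e.
  by have := orbit k.+1 _ e => ji; rewrite ji in e; case: (orbit0 _ e).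
case: start => [//|st].
apply: contrapT => nex.
have qV0 : q^-1 != 0 by rewrite invr_eq0.
apply: (@finite_roots r (fun k => x i / q * q^-1 ^+ k)) => //.
  move=> k l e; apply: (@qz_inj (x i / q)^-1).
    by rewrite invr_eq0 mulf_neq0.
  by apply: invr_inj; rewrite /= !invfM !invrK -!exprVn.
elim=> [|k IH]; first by rewrite mulr1.
have [e|h|[j _ e]] := down _ IH.
- exfalso; apply: nex; exists k; rewrite -e exprVn exprS.
  by rewrite [q * _]mulrC mulrA !mulfVK ?expf_neq0.
- by rewrite exprSr mulrA.
- exfalso; have e' : x i * q ^ (- k.+1%:Z) = x j.
    by rewrite -e -exprnN exprVn exprS invfM mulrA.
  have ji := orbit _ _ e'; rewrite ji in e'; apply: (orbit0 k).
  by rewrite -{1}e' -exprnN mulfVK // expf_neq0.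
Qed.

End Classification.

(** * Maximal subrings avoiding an element *)

Section Subrings.
Variable K : fieldType.
Implicit Types (A B O : set K) (x y z : K).

Definition is_subring A :=
  [/\ A 1, forall x y, A x -> A y -> A (x - y)
    & forall x y, A x -> A y -> A (x * y)].

Definition adjoin A x : set K :=
  [set z | exists2 p : {poly K}, forall i, A p`_i & z = p.[x]].

Section SubringTheory.
Variable A : set K.
Hypothesis sA : is_subring A.

Lemma subring1 : A 1. Proof. by case: sA. Qed.
Lemma subringB x y : A x -> A y -> A (x - y).
Proof. by case: sA => _ h _; apply: h. Qed.
Lemma subringM x y : A x -> A y -> A (x * y).
Proof. by case: sA => _ _; apply. Qed.
Lemma subring0 : A 0. Proof. by rewrite -(subrr 1); apply: subringB subring1 subring1. Qed.
Lemma subringN x : A x -> A (- x).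
Proof. by rewrite -sub0r; apply: subringB subring0. Qed.
Lemma subringD x y : A x -> A y -> A (x + y).
Proof. by move=> ax ay; rewrite -[y]opprK; apply: subringB ax (subringN ay). Qed.
Lemma subringX x n : A x -> A (x ^+ n).
Proof.
move=> ax; elim: n => [|n IH]; first exact: subring1.
by rewrite exprS; apply: subringM.
Qed.
Lemma subring_sum (I : Type) (r : seq I) (P : pred I) (E : I -> K) :
  (forall i, P i -> A (E i)) -> A (\sum_(i <- r | P i) E i).
Proof. by move=> h; elim/big_ind: _ => //; [exact: subring0|exact: subringD]. Qed.
Lemma subring_nat n : A n%:R.
Proof.
elim: n => [|n IH]; first exact: subring0.
by rewrite -natr1; apply: subringD IH subring1.
Qed.
Lemma subring_int n : A n%:~R.
Proof.
case: n => n; first exact: subring_nat.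
by rewrite NegzE mulrNz; apply/subringN/subring_nat.
Qed.

Lemma adjoin_subring x : is_subring (adjoin A x).
Proof.
split.
- exists 1; last by rewrite hornerC.
  by move=> i; rewrite coef1; case: eqP => _; [exact: subring1|exact: subring0].
- move=> _ _ [p Ap ->] [r Ar ->]; exists (p - r); last by rewrite hornerD hornerN.
  by move=> i; rewrite coefB; apply: subringB.
- move=> _ _ [p Ap ->] [r Ar ->]; exists (p * r); last by rewrite hornerM.
  by move=> i; rewrite coefM; apply: subring_sum => j _; apply: subringM.
Qed.

Lemma sub_adjoin x z : A z -> adjoin A x z.
Proof.
move=> Az; exists z%:P; last by rewrite hornerC.
by move=> i; rewrite coefC; case: eqP => _ //; exact: subring0.
Qed.

Lemma mem_adjoin x : adjoin A x x.
Proof.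
exists 'X; last by rewrite hornerX.
by move=> i; rewrite coefX; case: eqP => _; [exact: subring1|exact: subring0].
Qed.

End SubringTheory.

Definition maximal_avoiding y O :=
  [/\ is_subring O, ~ O y &
   forall B, is_subring B -> (forall z, O z -> B z) -> ~ B y -> forall z, B z -> O z].

Lemma exists_maximal_avoiding A y : is_subring A -> ~ A y ->
  exists2 O, maximal_avoiding y O & forall z, A z -> O z.
Proof.
move=> sA nAy.
pose good B := [/\ is_subring B, ~ B y & forall z, A z -> B z].
have [|V [[V0|[sV nV AV]] mx]] := @Zorn_bigcup K [set B | B = set0 \/ good B].
- move=> F FP tot.
  case: (pselect (exists B, F B /\ good B)) => [[B0 [FB0 g0]]|no]; last first.
    left; apply/seteqP; split => // z [B FB Bz].
    by case: (FP _ FB) => [e|g]; [rewrite e in Bz | case: no; exists B].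
  right.
  have gd B z : F B -> B z -> good B by move=> /FP[->|].
  have A1 : B0 1 by case: g0 => s _ _; exact: subring1.
  have two z1 z2 : (\bigcup_(X in F) X)%classic z1 -> (\bigcup_(X in F) X)%classic z2 ->
      exists B, [/\ F B, good B, B z1 & B z2].
    move=> [B1 F1 h1] [B2 F2 h2]; case: (tot _ _ F1 F2) => s.
      by exists B2; split => //; [apply: gd h2|apply: s].
    by exists B1; split => //; [apply: gd h1|apply: s].
  split.
  + split; first by exists B0.
    * move=> z1 z2 h1 h2; have [B [FB [sB _ _] b1 b2]] := two _ _ h1 h2.
      by exists B => //; apply: subringB.
    * move=> z1 z2 h1 h2; have [B [FB [sB _ _] b1 b2]] := two _ _ h1 h2.
      by exists B => //; apply: subringM.
  + by move=> [B FB By]; have [_ nB _] := gd _ _ FB By.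
  + by move=> z Az; exists B0 => //; case: g0 => _ _; apply.
- exfalso; apply: (mx A); last by right.
  rewrite V0; split=> [z //|/(_ 1)]; apply; exact: subring1.
exists V => //; split => // B sB VB nB z Bz; apply: contrapT => nVz.
apply: (mx B); last by right; split => // w /AV/VB.
by split=> // /(_ z Bz).
Qed.

(** The argument of Chevalley's extension theorem: if neither [x] nor its inverse lay in [O],
    maximality would put [y] in both $O[x]$ and $O[x^{-1}]$, and the degrees of the two expressions
    could be lowered forever. *)
Lemma maximal_avoiding_valuation y O : y != 0 -> maximal_avoiding y O -> O y^-1 ->
  forall x, x != 0 -> O x \/ O x^-1.
Proof.
move=> y0 [sO nO mx] Oy.
have key x : ~ O x -> exists2 p : {poly K}, forall i, O p`_i & p.[x] = y.
  move=> nx; apply: contrapT => no; apply: nx.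
  apply: (mx (adjoin O x)); [exact: adjoin_subring|exact: sub_adjoin| |exact: mem_adjoin].
  by case=> p Op e; apply: no; exists p.
(* So $1/y$ is in the Jacobson radical. Otherwise [y] is a polynomial in $w^{-1}$, hence $y w^n \in
   O$ for some [n]; since $w^n = 1 - z/y$ with $z \in O$, this forces $y \in O$. *)
have unit1 a : O a -> O (1 - a / y)^-1.
  move=> Oa; set w := 1 - _.
  have w0 : w != 0.
    apply/eqP => /subr0_eq e; apply: nO.
    by rewrite -[y]mul1r e mulfVK.
  apply: contrapT => /key[p Op e]; apply: nO.
  have wn n : exists2 z, O z & w ^+ n = 1 - z / y.
    elim: n => [|n [z Oz e']]; first by exists 0; [exact: subring0|rewrite mul0r subr0].
    exists (a + z - a * z / y).
      apply: subringB => //; first exact: subringD.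
      by apply: subringM => //; apply: subringM.
    by rewrite exprS e' /w; field.
  have [z Oz e'] := wn (size p).
  suff: O (y * w ^+ size p).
    rewrite e' mulrBr mulr1 mulrCA mulfV // mulr1 => h.
    by rewrite -[y](subrK z); apply: subringD.
  rewrite -e horner_coef mulr_suml; apply: subring_sum => // i _.
  rewrite -mulrA [_ * w ^+ _]mulrC exprVn -expfB //.
  apply: subringM => //; apply: subringX => //.
  rewrite /w; apply: subringB => //; [exact: subring1|exact: subringM].
have step x (p r : {poly K}) : x != 0 -> (forall i, O p`_i) -> (forall i, O r`_i) ->
    p.[x] = y -> r.[x^-1] = y -> (size r <= size p)%N ->
    exists p' : {poly K}, [/\ forall i, O p'`_i, p'.[x] = y & (size p' < size p)%N].
  move=> x0 Op Or ep er le.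
  have sp : (0 < size p)%N.
    rewrite size_poly_gt0; apply: contraNneq y0 => p0.
    by rewrite -ep p0 horner0.
  pose n := (size p).-1; have sn : size p = n.+1 by rewrite prednK.
  pose w := (1 - r`_0 / y)^-1; have Ow : O w by apply: unit1.
  (* The relation $r(x^{-1}) = y$ solves to $x^n = (w/y)\sum_{i<n} r_{n-i} x^i$; substituting this
     for the top power in [p] lowers its degree. *)
  pose p' := \poly_(i < n) (p`_i + p`_n * (w / y * r`_(n - i))).
  exists p'; split.
  - move=> i; rewrite coef_poly; case: ifP => _; last exact: subring0.
    by apply: subringD => //; apply: subringM => //; apply: subringM => //; apply: subringM.
  - rewrite (horner_coef_wide _ (size_poly _ _)) -{2}ep horner_coef sn big_ord_recr /=.
    under eq_bigr => i _ do rewrite coef_poly ltn_ord mulrDl.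
    rewrite big_split /=; congr (_ + _).
    under eq_bigr => i _ do rewrite -!mulrA.
    rewrite -mulr_sumr; congr (_ * _); rewrite -mulr_sumr -mulr_sumr.
    have yr : y - r`_0 != 0.
      by rewrite subr_eq0; apply/eqP => e; apply: nO; rewrite e.
    have -> : \sum_(i < n) r`_(n - i) * x ^+ i = x ^+ n * (y - r`_0).
      rewrite -{1}er (@horner_coef_wide _ n.+1); last by rewrite -sn.
      rewrite big_ord_recl expr0 mulr1 addrC addKr mulr_sumr.
      rewrite (reindex_inj rev_ord_inj) /=; apply: eq_bigr => i _.
      rewrite /bump /= add1n subKn // mulrCA; congr (_ * _).
      have expB a b : (b <= a)%N -> x ^+ (a - b) = x ^+ a / x ^+ b.
        by move=> h; rewrite -{2}(subnK h) exprD mulfK ?expf_neq0.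
      by rewrite exprVn expB.
    by rewrite /w; field; rewrite yr y0.
  - by rewrite sn ltnS size_poly.
move=> x x0; apply: contrapT => /not_orP[/key[p Op ep] /key[r Or er]].
have [k] : exists k, (size p + size r < k)%N by exists (size p + size r).+1.
elim: k => // k IH in p r Op ep Or er *.
rewrite ltnS => le.
case: (leqP (size r) (size p)) => sz.
  have [p' [Op' ep' sp']] := step _ _ _ x0 Op Or ep er sz.
  by apply: (IH p' r) => //; apply: leq_trans le; rewrite ltn_add2r.
have xV : x^-1 != 0 by rewrite invr_eq0.
have [|r' [Or' er' sr']] := step _ _ _ xV Or Op er _ (ltnW sz); first by rewrite invrK.
by apply: (IH p r') => //; apply: leq_trans le; rewrite ltn_add2l.
Qed.

End Subrings.

(** * Valuation rings of a number field *)

Lemma fext_intr_eq0 (K : fieldExtType rat) (a : int) : (a%:~R == 0 :> K) = (a == 0).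
Proof. by rewrite -(rmorph_int (in_alg K)) fmorph_eq0 intr_eq0. Qed.

Lemma fext_natr_eq0 (K : fieldExtType rat) (n : nat) : (n%:R == 0 :> K) = (n == 0%N).
Proof. exact: (fext_intr_eq0 K n). Qed.

Lemma int_relation (K : fieldExtType rat) (x : K) : exists p : {poly int},
  [/\ p != 0, (size p <= (\dim {:K}).+1)%N
    & \sum_(i < size p) (p`_i)%:~R * x ^+ i = 0].
Proof.
have /polyOver1P[r er] := minPolyOver 1 x.
have mr := monic_minPoly 1 x.
have rx := root_minPoly 1 x.
have sr := size_minPoly 1 x.
rewrite er in mr rx sr.
have [p [a a0 ep]] := rat_poly_scale r.
have aQ : a%:~R != 0 :> rat by rewrite intr_eq0.
have sp : size p = size r.
  by rewrite ep size_scale ?invr_eq0 // size_map_inj_poly //; exact: intr_inj.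
have r0 : r != 0.
  by apply: contraTneq mr => ->; rewrite rmorph0 monicE lead_coef0 eq_sym oner_eq0.
exists p; split.
- by rewrite -size_poly_eq0 sp size_poly_eq0.
- rewrite sp; move: sr; rewrite size_map_poly => ->; rewrite ltnS adjoin_degreeE dimv1 divn1.
  exact/dimvS/subvf.
- move/rootP: rx; rewrite horner_coef size_map_poly -sp => e.
  transitivity (a%:~R *: (\sum_(i < size p) (map_poly (in_alg K) r)`_i * x ^+ i)).
    rewrite scaler_sumr; apply: eq_bigr => i _.
    rewrite coef_map /= ep coefZ coef_map /= scalerAl scalerA mulVKf //.
    by rewrite scaler_int.
  by rewrite e scaler0.
Qed.

Section ValuationRing.
Variables (K : fieldExtType rat) (O : set K).
Hypothesis sO : is_subring O.
Hypothesis valO : forall x, x != 0 -> O x \/ O x^-1.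

Definition vunit (x : K) := [/\ x != 0, O x & O x^-1].

Lemma vunitM x y : vunit x -> vunit y -> vunit (x * y).
Proof.
move=> [x0 ox ox'] [y0 oy oy']; split; first by rewrite mulf_neq0.
- exact: subringM.
- by rewrite invfM; apply: subringM.
Qed.

Lemma vunitV x : vunit x -> vunit x^-1.
Proof. by move=> [x0 ox ox']; split; rewrite ?invr_eq0 ?invrK. Qed.

Lemma vunitX x n : vunit x -> vunit (x ^+ n).
Proof.
move=> h; elim: n => [|n IH]; last by rewrite exprS; apply: vunitM.
by split; rewrite ?invr1 ?oner_neq0 //; exact: subring1.
Qed.

(** A valuation ring is local: one of [x / y], [y / x] is in [O], so the sum is an [O]-multiple of
    one summand, which must then be a unit. *)
Lemma vunit_addl x y : O x -> O y -> vunit (x + y) -> vunit x \/ vunit y.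
Proof.
wlog: x y / O (x / y) /\ y != 0.
  move=> W ox oy u; have [y0|y0] := eqVneq y 0.
    by left; rewrite y0 addr0 in u.
  have [x0|x0] := eqVneq x 0; first by right; rewrite x0 add0r in u.
  have [|h|] := @valO (x / y); first by rewrite mulf_neq0 ?invr_eq0.
    by apply: W.
  rewrite invfM invrK mulrC => h; apply/or_comm; apply: W => //.
  by rewrite addrC.
move=> [oxy y0] ox oy [n0 _ h]; right; split => //.
rewrite -[y^-1](mulfK n0) mulrDr mulVf // mulrC; apply: subringM => //.
by rewrite mulrC; apply: subringD => //; exact: subring1.
Qed.

Lemma vunit_sum (n : nat) (t : nat -> K) : (forall i, (i < n)%N -> O (t i)) ->
  vunit (\sum_(i < n) t i) -> exists2 i, (i < n)%N & vunit (t i).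
Proof.
elim: n => [|n IH] h; first by rewrite big_ord0 => -[]; rewrite eqxx.
rewrite big_ord_recr /= => U; have [||u|u] := vunit_addl _ _ U.
- by apply: subring_sum => // i _; apply: h; exact: ltnW (ltn_ord i).
- exact: h.
- by have [i lt ui] := IH (fun i lt => h i (ltnW lt)) u; exists i => //; apply: ltnW.
- by exists n.
Qed.

(** Divisibility is total, so among finitely many terms one has the largest absolute value. *)
Lemma dominant (n : nat) (t : nat -> K) : (exists2 i, (i < n)%N & t i != 0) ->
  exists i, [/\ (i < n)%N, t i != 0 & forall j, (j < n)%N -> O (t j / t i)].
Proof.
elim: n => [[]//|n IH] [i0 lt0 nz].
case: (pselect (exists2 i, (i < n)%N & t i != 0)) => [/IH[i [lt ti h]]|no].
  have [z|tn] := eqVneq (t n) 0.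
    exists i; split; [exact: ltnW|by []|move=> j].
    rewrite ltnS leq_eqVlt => /orP[/eqP ->|/h //].
    by rewrite z mul0r; exact: subring0.
  have [|v|v] := @valO (t n / t i); first by rewrite mulf_neq0 ?invr_eq0.
    exists i; split; [exact: ltnW|by []|move=> j].
    by rewrite ltnS leq_eqVlt => /orP[/eqP ->|/h].
  exists n; split => // j; rewrite ltnS leq_eqVlt => /orP[/eqP ->|/h v'].
    by rewrite divff //; exact: subring1.
  have -> : t j / t n = t j / t i * (t n / t i)^-1 by field; rewrite ti tn.
  exact: subringM.
have z j : (j < n)%N -> t j = 0.
  by move=> lt; apply/eqP; apply: contraT => h; case: no; exists j.
have tn : t n != 0.
  move: lt0 nz; rewrite ltnS leq_eqVlt => /orP[/eqP -> //|/z ->].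
  by rewrite eqxx.
exists n; split => // j; rewrite ltnS leq_eqVlt => /orP[/eqP ->|/z ->].
  by rewrite divff //; exact: subring1.
by rewrite mul0r; exact: subring0.
Qed.

(** Otherwise [O] contains all rationals as well as $y^{-1}$; dividing an integer relation for [y]
    by its leading coefficient and a power of [y] writes [y] as a rational polynomial in
    $y^{-1}$. *)
Lemma residue_prime y : ~ O y -> exists2 p, prime p & ~ O (p%:R^-1).
Proof.
move=> nOy; apply: contrapT => no.
have nat_inv n : O (n%:R^-1).
  elim/ltn_ind: n => n IH.
  case: (ltnP 1 n) => [n1|]; last first.
    case: n {IH} => [|[|//]] _; first by rewrite invr0; exact: subring0.
    by rewrite invr1; exact: subring1.
  rewrite -(divnK (pdiv_dvd n)) natrM invfM; apply: subringM => //.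
    by apply: IH; rewrite ltn_Pdiv ?prime_gt1 ?pdiv_prime // ltnW.
  by apply: contrapT => h; apply: no; exists (pdiv n) => //; apply: pdiv_prime.
have int_inv (a : int) : O (a%:~R^-1).
  by case: a => a; rewrite ?NegzE ?mulrNz ?invrN; [|apply: subringN]; rewrite // -?pmulrn.
have y0 : y != 0 by apply/eqP => e; apply: nOy; rewrite e; exact: subring0.
have [//|Oy] := valO y0.
have [p [p0 _ e]] := int_relation y.
case: (leqP (size p) 1) => sp.
  have s1 : size p = 1%N by apply/eqP; rewrite eqn_leq sp size_poly_gt0.
  move: e; rewrite s1 big_ord1 expr0 mulr1 => /eqP. rewrite fext_intr_eq0.
  by have := lead_coef_eq0 p; rewrite /lead_coef s1 /= (negPf p0) => ->.
pose n := (size p).-2.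
have sn : size p = n.+2 by rewrite /n; case: (size p) sp => [|[|]].
have ln : (p`_n.+1)%:~R != 0 :> K.
  by rewrite fext_intr_eq0; have := lead_coef_eq0 p; rewrite /lead_coef sn /= (negPf p0) => ->.
apply: nOy.
have -> : y = - \sum_(i < n.+1) (p`_i)%:~R / (p`_n.+1)%:~R * y^-1 ^+ (n - i).
  apply: (mulIf (expf_neq0 n y0)); apply: (mulfI ln).
  rewrite -exprS; move/eqP: e; rewrite sn big_ord_recr /= addrC addr_eq0 => /eqP ->.
  rewrite mulNr mulrN mulr_suml mulr_sumr; congr (- _); apply: eq_bigr => i _.
  have le : (i <= n)%N by rewrite -ltnS.
  have -> : y ^+ n = y ^+ (n - i) * y ^+ i by rewrite -exprD subnK.
  by rewrite exprVn; field; rewrite ln expf_neq0.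
apply: subringN => //; apply: subring_sum => // i _.
apply: subringM => //; last exact: subringX.
by apply: subringM => //; exact: subring_int.
Qed.

Section Prime.
Variable p : nat.
Hypotheses (p_pr : prime p) (Op : ~ O (p%:R^-1)).

Let p0 : p%:R != 0 :> K.
Proof. by rewrite fext_natr_eq0 -lt0n prime_gt0. Qed.

(** Bézout for the prime-to-[p] part [m]: with $ap + bm = 1$, $m/p \in O$ would give $1/p \in O$;
    hence $p/m \in O$, and then $1/m \in O$. *)
Lemma vunit_nat n : (0 < n)%N -> vunit (n%:R / p%:R ^+ logn p n).
Proof.
move=> n0; have [m cop e] := pfactor_coprime p_pr n0.
have -> : n%:R / p%:R ^+ logn p n = m%:R :> K.
  by rewrite {1}e natrM natrX mulfK // expf_neq0.
have m0 : m%:R != 0 :> K.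
  by rewrite fext_natr_eq0; apply: contraTneq n0 => z; rewrite e z.
split => //; first exact: subring_nat.
have /coprimezP[[a b] /= ab] : coprimez p m by rewrite coprimezE.
have abK : a%:~R * p%:R + b%:~R * m%:R = 1 :> K.
  by move/(congr1 (fun z : int => z%:~R : K)): ab; rewrite rmorphD !rmorphM.
have [|h|] := @valO (m%:R / p%:R); first by rewrite mulf_neq0 ?invr_eq0.
  exfalso; apply: Op.
  have -> : p%:R^-1 = a%:~R + b%:~R * (m%:R / p%:R) :> K.
    by rewrite mulrA -{1}[_^-1]mul1r -[X in X * _ = _]abK mulrDl mulfK.
  by apply: subringD => //; [|apply: subringM]; rewrite //; exact: subring_int.
rewrite invfM invrK mulrC => h.
have -> : m%:R^-1 = a%:~R * (p%:R / m%:R) + b%:~R :> K.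
  by rewrite mulrA -{1}[_^-1]mul1r -[X in X * _ = _]abK mulrDl mulfK.
by apply: subringD => //; [apply: subringM|]; rewrite //; exact: subring_int.
Qed.

Lemma vunit_int (a : int) : a != 0 -> exists k : nat, vunit (a%:~R / p%:R ^+ k).
Proof.
move=> a0; have := @vunit_nat `|a|%N; rewrite absz_gt0 => /(_ a0) u.
exists (logn p `|a|%N).
have [s|s] : a%:~R = `|a|%N%:R :> K \/ a%:~R = - `|a|%N%:R :> K.
- by case: a {a0 u} => a; [left|right; rewrite NegzE mulrNz].
- by rewrite s.
- rewrite s mulNr; case: u => [z o o']; split; rewrite ?oppr_eq0 // ?invrN; exact: subringN.
Qed.

(** In an integer relation $\sum P_i x^i = 0$ two terms share the dominant absolute value, so
    $x^{i-i_0}$ is a unit times a power of [p]. As $|i - i_0|$ is at most the degree, the factorial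
    is an exponent valid for all [x]. *)
Lemma vunit_power (x : K) : x != 0 ->
  exists k : int, vunit (x ^+ (\dim {:K})`! / p%:R ^ k).
Proof.
move=> x0; have [P [P0 sP e]] := int_relation x.
pose t i : K := (P`_i)%:~R * x ^+ i.
have [|i0 [lt0 nz0 dom]] := @dominant (size P) t.
  exists (size P).-1; first by rewrite prednK // size_poly_gt0.
  by rewrite mulf_neq0 ?expf_neq0 // fext_intr_eq0 -/(lead_coef P) lead_coef_eq0.
have [i [lti nei u]] : exists i, [/\ (i < size P)%N, i != i0 & vunit (t i / t i0)].
  (* Zeroing the dominant term leaves quotients with sum $-1$, a unit, so one of them is a unit. *)
  pose s i := if i == i0 then 0 else t i / t i0.
  have sE : \sum_(i < size P) s i = - 1.
    have := congr1 (fun z => z / t i0) e.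
    rewrite mul0r mulr_suml (bigD1 (Ordinal lt0)) //= -/(t i0) divff // => /eqP.
    rewrite addrC addr_eq0 => /eqP <-; rewrite (bigD1 (Ordinal lt0)) //= /s eqxx add0r.
    by apply: eq_bigr => j; rewrite -val_eqE /= => /negPf ->.
  have [||i lti] := @vunit_sum (size P) s.
  - by move=> j lt; rewrite /s; case: eqP => _; [exact: subring0|exact: dom].
  - rewrite sE; split; rewrite ?oppr_eq0 ?oner_neq0 ?invrN ?invr1 //;
      apply: subringN => //; exact: subring1.
  rewrite /s; case: eqP => [_ [] |ne u]; first by rewrite eqxx.
  by exists i; split => //; apply/eqP.
have [d [k [d0 dd ud]]] : exists (d : nat) (k : int),
    [/\ (0 < d)%N, (d <= \dim {:K})%N & vunit (x ^+ d / p%:R ^ k)].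
  have nzi : t i != 0 by case: u; rewrite mulf_eq0 negb_or => /andP[].
  have [k uk] : exists k, vunit ((P`_i)%:~R / p%:R ^+ k).
    by apply: vunit_int; apply: contraNneq nzi => z; rewrite /t z mul0r.
  have [k0 uk0] : exists k, vunit ((P`_i0)%:~R / p%:R ^+ k).
    by apply: vunit_int; apply: contraNneq nz0 => z; rewrite /t z mul0r.
  have Pi : (P`_i)%:~R != 0 :> K by apply: contraNneq nzi => z; rewrite /t z mul0r.
  have Pi0 : (P`_i0)%:~R != 0 :> K by apply: contraNneq nz0 => z; rewrite /t z mul0r.
  have uu := vunitM (vunitM u uk0) (vunitV uk).
  have {uu} : vunit (x ^+ i / x ^+ i0 / p%:R ^ (k0%:Z - k%:Z)).
    move: uu; congr vunit; rewrite /t expfzDr // -exprnN -exprnP.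
    move: (expf_neq0 i0 x0) (expf_neq0 k p0) (expf_neq0 k0 p0) Pi Pi0.
    move: (x ^+ i0) (x ^+ i) (p%:R ^+ k) (p%:R ^+ k0) (_ P`_i) (_ P`_i0) => a b c d g h.
    by move=> a0 c0 d0 g0 h0; field; rewrite a0 c0 d0 g0 h0.
  have szd a b : (a < size P)%N -> (a - b <= \dim {:K})%N.
    by move=> ?; move: sP; lia.
  case: (ltngtP i i0) nei => // lt _ uu.
    exists (i0 - i)%N, (k%:Z - k0%:Z); split; [by rewrite subn_gt0|exact: szd|].
    move/vunitV: uu; congr vunit.
    rewrite expfB // -[k%:Z - _]opprB -invr_expz invrK !invfM !invrK.
    by congr (_ * _); exact: mulrC.
  exists (i - i0)%N, (k0%:Z - k%:Z); split; [by rewrite subn_gt0|exact: szd|].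
  by move: uu; rewrite expfB.
have /dvdnP[a ea] : (d %| (\dim {:K})`!)%N by rewrite dvdn_fact // d0.
exists (k * a%:Z); have := vunitX a ud.
by rewrite expr_div_n -exprM ea mulnC -exprz_exp.
Qed.

End Prime.
End ValuationRing.

(** * Absolute values from valuation rings, and integrality *)

Definition intset (K : fieldType) : set K := [set z | exists n : int, z = n%:~R].

Lemma intset_subring (K : fieldType) : is_subring (@intset K).
Proof.
split; first by exists 1.
- by move=> _ _ [a ->] [b ->]; exists (a - b); rewrite rmorphB.
- by move=> _ _ [a ->] [b ->]; exists (a * b); rewrite rmorphM.
Qed.

(* The exponent [e] bounds the ramification, which makes estimates uniform over
   all places of this kind. *)
Definition padic_absval (K : fieldType) (R : realType) (e : nat) (f : K -> R) :=
  [/\ is_absval f, ultrametric_absval f & exists2 p, prime p &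
     (forall n, (0 < n)%N -> f n%:R = (p%:R ^+ logn p n)^-1) /\
     (forall x, x != 0 -> exists k : int, f x ^+ e = p%:R ^ k)].

Section PlaceOfValuationRing.
Variables (K : fieldExtType rat) (R : realType) (O : set K).
Hypothesis sO : is_subring O.
Hypothesis valO : forall x, x != 0 -> O x \/ O x^-1.
Variables (y : K) (nOy : ~ O y).

Lemma padic_absval_of_valuation :
  exists2 f : K -> R, padic_absval (\dim {:K})`! f & forall x, O x <-> f x <= 1.
Proof.
have [p p_pr Op] := residue_prime sO valO nOy.
set e := _`!.
have e0 : (0 < e)%N by rewrite fact_gt0.
have p0 : p%:R != 0 :> K by rewrite fext_natr_eq0 -lt0n prime_gt0.
have pR : 0 < p%:R :> R by rewrite ltr0n prime_gt0.
have pR0 : p%:R != 0 :> R by rewrite gt_eqF.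
(* [v0] is [e] times the valuation normalized by $v(p) = 1$; its value at zero is arbitrary, as [f]
   treats zero separately. *)
have /choice[v0 hv0] (x : K) : exists k : int, x != 0 -> vunit O (x ^+ e / p%:R ^ k).
  have [->|x0] := eqVneq x 0; first by exists 0.
  by have [k hk] := vunit_power sO valO p_pr Op x0; exists k.
have upk (k : int) : vunit O (p%:R ^ k) -> k = 0.
  have key (n : nat) : ~ O (p%:R ^ (- n.+1%:Z)).
    rewrite -exprnN => h; apply: Op.
    have -> : p%:R^-1 = p%:R ^- n.+1 * p%:R ^+ n :> K.
      by rewrite exprS invfM -mulrA mulVf ?mulr1 // expf_neq0.
    by apply: subringM => //; apply: subringX => //; exact: subring_nat.
  move=> [_ h h']; case: k h h' => [[|n]|n] h h' //; exfalso.
    by apply: (key n); rewrite -exprnN.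
  by move: h; rewrite NegzE => /key.
have uniq (x : K) k l : vunit O (x / p%:R ^ k) -> vunit O (x / p%:R ^ l) -> k = l.
  move=> uk ul; have := vunitM sO ul (vunitV uk).
  have x0 : x != 0 by case: uk; rewrite mulf_eq0 negb_or => /andP[].
  have -> : x / p%:R ^ l * (x / p%:R ^ k)^-1 = p%:R ^ (k - l).
    rewrite expfzDr // -invr_expz invfM invrK.
    by rewrite mulrACA mulfV // mul1r mulrC.
  by move/upk/eqP; rewrite subr_eq0 => /eqP.
have vM x z : x != 0 -> z != 0 -> v0 (x * z) = v0 x + v0 z.
  move=> x0 z0; apply: (uniq ((x * z) ^+ e)); first by apply: hv0; rewrite mulf_neq0.
  have := vunitM sO (hv0 _ x0) (hv0 _ z0).
  by rewrite exprMn expfzDr // invfM mulrACA.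
have vO x : x != 0 -> O x <-> 0 <= v0 x.
  move=> x0; have [u0 u u'] := hv0 _ x0; split => [Ox|].
    case: (v0 x) u u' => // n u u'; exfalso; apply: Op.
    have -> : p%:R^-1 = x ^+ e * p%:R ^+ n * (x ^+ e / p%:R ^ (Negz n))^-1 :> K.
      rewrite NegzE -exprnN invrK exprS invfM.
      move: (expf_neq0 e x0) (expf_neq0 n p0).
      move: (x ^+ e) (p%:R ^+ n) p0 => a b; move: (_ *+ p) => c c0 a0 b0.
      by field; rewrite ?a0 ?b0 ?c0.
    apply: subringM => //; apply: subringM => //; apply: subringX => //.
    exact: subring_nat.
  case: (v0 x) u u' => // n u u' _.
  have Oxe : O (x ^+ e).
    have -> : x ^+ e = x ^+ e / p%:R ^ n%:Z * p%:R ^+ n by rewrite mulfVK // expf_neq0.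
    by apply: subringM => //; apply: subringX => //; exact: subring_nat.
  have [//|Ox'] := valO x0.
  have -> : x = x ^+ e * x^-1 ^+ e.-1.
    by rewrite -{1}(prednK e0) exprS -mulrA -exprMn mulfV // expr1n mulr1.
  by apply: subringM => //; apply: subringX.
pose f x : R := if x == 0 then 0 else p%:R `^ (- (v0 x)%:~R / e%:R).
have f0 : f 0 = 0 by rewrite /f eqxx.
have fgt x : x != 0 -> 0 < f x by move=> x0; rewrite /f (negPf x0) powR_gt0.
have fge x : 0 <= f x.
  by have [->|x0] := eqVneq x 0; [rewrite f0|apply/ltW/fgt].
have eR : e%:R != 0 :> R by rewrite pnatr_eq0 -lt0n.
have fM x z : f (x * z) = f x * f z.
  have [->|x0] := eqVneq x 0; first by rewrite mul0r f0 mul0r.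
  have [->|z0] := eqVneq z 0; first by rewrite mulr0 f0 mulr0.
  rewrite /f mulf_eq0 (negPf x0) (negPf z0) /= vM // -powRD; last by rewrite pR0 implybT.
  by rewrite intrD opprD mulrDl.
have fe x : x != 0 -> f x ^+ e = p%:R ^ (- v0 x).
  move=> x0; rewrite /f (negPf x0) -powR_mulrn ?powR_ge0 // -powRrM mulfVK //.
  by rewrite -mulrNz powR_intmul // ltW.
have p1 : 1 < p%:R :> R by rewrite ltr1n prime_gt1.
have fO x : O x <-> f x <= 1.
  have [->|x0] := eqVneq x 0.
    by rewrite f0; split => // _; exact: subring0.
  rewrite vO //; have -> : (f x <= 1) = (f x ^+ e <= 1) by rewrite expr_le1.
  by rewrite fe //; have := ler_eXz2l p1 (- v0 x) 0; rewrite expr0z => ->; rewrite oppr_le0.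
have f1 : f 1 = 1.
  have := fM 1 1; rewrite mulr1 => /eqP; rewrite -subr_eq0 -{1}[f 1]mulr1 -mulrBr.
  by rewrite mulf_eq0 (gt_eqF (fgt _ (oner_neq0 _))) subr_eq0 => /eqP.
have fV x : f x^-1 = (f x)^-1.
  have [->|x0] := eqVneq x 0; first by rewrite invr0 f0 invr0.
  by apply: (mulfI (lt0r_neq0 (fgt _ x0))); rewrite -fM !mulfV ?f1 // gt_eqF // fgt.
have fu x : vunit O x -> f x = 1.
  move=> [x0 /fO h /fO h']; apply/eqP; rewrite eq_le h /=.
  by move: h'; rewrite fV invf_le1 // fgt.
have ultra : ultrametric_absval f.
  move=> x z; wlog le : x z / f x <= f z.
    by move=> W; case/orP: (le_total (f x) (f z)) => h;
      [|rewrite addrC maxC]; apply: W.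
  rewrite (max_idPr le).
  have [z0|z0] := eqVneq z 0; first by move: le; rewrite z0 addr0.
  have -> : x + z = z * (1 + x / z) by rewrite mulrDr mulr1 mulrCA mulfV // mulr1 addrC.
  rewrite fM ler_piMr //; apply/fO; apply: subringD => //; first exact: subring1.
  by apply/fO; rewrite fM fV ler_pdivrMr ?mul1r // fgt.
have fp : f p%:R = p%:R^-1.
  have vp : v0 p%:R = e.
    apply: (uniq (p%:R ^+ e)); first exact: hv0.
    by rewrite divff ?expf_neq0 //; split; rewrite ?invr1 ?oner_neq0 //; exact: subring1.
  rewrite /f (negPf p0) vp mulNr divff // powR_inv1 //; exact: ltW.
have fX x n : f (x ^+ n) = f x ^+ n.
  by elim: n => [|n IH]; rewrite ?f1 // !exprS fM IH.
exists f => //; split => //.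
- split => //.
    move=> x z; apply: le_trans (ultra x z) _.
    by rewrite ge_max lerDl lerDr !fge.
  by exists p%:R; rewrite fp; split => //; rewrite invr_eq1 gt_eqF.
- exists p => //; split => [n n0|x x0]; last by exists (- v0 x); apply: fe.
  have := fu _ (vunit_nat sO valO p_pr Op n0); rewrite fM fV fX fp => /eqP.
  by rewrite exprVn invrK -[X in _ == X](@mulVf _ (p%:R ^+ logn p n)) ?expf_neq0 // =>
     /eqP/(mulIf (expf_neq0 _ pR0)).
Qed.

End PlaceOfValuationRing.

(** Membership of [y] in $\mathbb{Z}[y^{-1}]$ expresses that [y] is integral. If it fails, a maximal
    subring avoiding [y] above $\mathbb{Z}[y^{-1}]$ is a valuation ring, whose absolute value
    exceeds 1 at [y]. *)
Lemma integral_of_places (K : fieldExtType rat) (R : realType) (y : K) :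
  (forall f : K -> R, padic_absval (\dim {:K})`! f -> f y <= 1) ->
  adjoin (@intset K) y^-1 y.
Proof.
move=> h; apply: contrapT => nA.
have sA := adjoin_subring (intset_subring K) y^-1.
have y0 : y != 0 by apply/eqP => e; apply: nA; rewrite {2}e; exact: subring0.
have [V mV AV] := exists_maximal_avoiding sA nA.
have [sV nVy _] := mV.
have Vy : V y^-1 by apply: AV; apply: mem_adjoin; exact: intset_subring.
have val := maximal_avoiding_valuation y0 mV Vy.
have [f pf fV] := padic_absval_of_valuation R sV val nVy.
by apply: nVy; apply/fV/h.
Qed.

(** * Regular representation and complex embeddings *)

Section RegularRepresentation.
Import VectorInternalTheory.
Variable K : fieldExtType rat.
Local Notation d := (dim K).

Definition regmx (x : K) : 'M[rat]_d := lin1_mx (v2r \o (x \o* r2v)).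

Lemma mul_regmx (r : 'rV_d) x : r *m regmx x = v2r (r2v r * x).
Proof. by rewrite mul_rV_lin1. Qed.

Lemma mulmx_row_inj (A B : 'M[rat]_d) : (forall r : 'rV_d, r *m A = r *m B) -> A = B.
Proof. by move=> h; apply/row_matrixP => i; rewrite !rowE. Qed.

Lemma regmxM x y : regmx (x * y) = regmx x *m regmx y.
Proof. by apply: mulmx_row_inj => r; rewrite mulmxA !mul_regmx v2rK mulrA. Qed.

Lemma regmx1 : regmx 1 = 1%:M.
Proof. by apply: mulmx_row_inj => r; rewrite mul_regmx mulr1 r2vK mulmx1. Qed.

Lemma regmxD x y : regmx (x + y) = regmx x + regmx y.
Proof. by apply: mulmx_row_inj => r; rewrite mulmxDr !mul_regmx mulrDr linearD. Qed.

Lemma regmxZ a x : regmx (a *: x) = a *: regmx x.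
Proof. by apply: mulmx_row_inj => r; rewrite -scalemxAr !mul_regmx -scalerAr linearZ. Qed.

Lemma regmx0 : regmx 0 = 0.
Proof. by rewrite -(scale0r 0) regmxZ scale0r. Qed.

Lemma regmx_sum (I : Type) (r : seq I) (P : pred I) (E : I -> K) :
  regmx (\sum_(i <- r | P i) E i) = \sum_(i <- r | P i) regmx (E i).
Proof. exact: (big_morph _ regmxD regmx0). Qed.

Lemma det_regmx_neq0 x : x != 0 -> \det (regmx x) != 0.
Proof.
move=> x0; have : \det (regmx x) * \det (regmx x^-1) = 1.
  by rewrite -det_mulmx -regmxM mulfV // regmx1 det1.
by move=> e; apply/eqP => z; move/eqP: e; rewrite z mul0r eq_sym oner_eq0.
Qed.

End RegularRepresentation.

Lemma trig_mulmx_diag (C : fieldType) n (A B : 'M[C]_n) i :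
  is_trig_mx A -> is_trig_mx B -> (A *m B) i i = A i i * B i i.
Proof.
move=> /is_trig_mxP tA /is_trig_mxP tB; rewrite mxE (bigD1 i) //= big1 ?addr0 //.
move=> k; rewrite neq_ltn => /orP[lt|lt]; first by rewrite tB // mulr0.
by rewrite tA // mul0r.
Qed.

Section Embeddings.
Variables (K : fieldExtType rat) (R : realType).
Local Notation C := R[i].
Local Notation d := (dim K).

(** The matrices of multiplication commute, so one change of basis triangularizes them all over
    [R[i]]. Their diagonal entries are multiplicative, and the product of these is the norm. *)
Lemma complex_embeddings : exists s : 'I_d -> K -> C,
  [/\ forall i x y, s i (x + y) = s i x + s i y,
      forall i x y, s i (x * y) = s i x * s i y,
      forall i, s i 1 = 1 &
      forall x, \prod_i s i x = ratr (\det (regmx x))].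
Proof.
pose M (x : K) : 'M[C]_d := map_mx ratr (regmx x).
have MM x y : M (x * y) = M x *m M y by rewrite /M regmxM map_mxM.
have Mcomm x y : M x *m M y = M y *m M x by rewrite -!MM mulrC.
have [|P Pu /allP hP] := @cotrigonalization C d [seq M b | b <- vbasis {:K}].
  by move=> _ _ /mapP[b _ ->] /mapP[b' _ ->]; apply: Mcomm.
have Pun := unitarymx_unit Pu.
pose D x := P *m M x *m invmx P.
have DD x y : D (x + y) = D x + D y.
  by rewrite /D /M regmxD map_mxD mulmxDr mulmxDl.
have DZ a x : D (a *: x) = ratr a *: D x.
  by rewrite /D /M regmxZ map_mxZ -scalemxAr -scalemxAl.
have D0 : D 0 = 0 by rewrite -(scale0r 0) DZ rmorph0 scale0r.
have tD x : is_trig_mx (D x).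
  rewrite (coord_vbasis (memvf x)) (big_morph _ DD D0).
  apply/is_trig_mxP => i j ij; rewrite summxE big1 // => k _; rewrite DZ mxE.
  have /hP : M (vbasis {:K})`_k \in [seq M b | b <- vbasis {:K}].
    by apply/map_f/mem_nth; rewrite size_tuple.
  rewrite /= /similar_to conjumx // => /is_trig_mxP -> //; exact: mulr0.
have DM x y : D (x * y) = D x *m D y.
  by rewrite /D MM !mulmxA mulmxKV.
exists (fun i x => D x i i); split.
- by move=> i x y; rewrite DD mxE.
- by move=> i x y; rewrite DM trig_mulmx_diag.
- by move=> i; rewrite /D /M regmx1 map_mx1 mulmx1 mulmxV // mxE eqxx.
- move=> x; rewrite -det_trig // /D !det_mulmx det_inv mulrAC mulfV ?mul1r.
    by rewrite /M det_map_mx.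
  by rewrite -unitfE -unitmxE.
Qed.

Lemma archimedean_absvals : exists s : 'I_d -> K -> R,
  (forall i, [/\ is_absval (s i), ~ ultrametric_absval (s i) &
                 forall n : nat, s i n%:R = n%:R]) /\
  (forall x, \prod_i s i x = `|ratr (\det (regmx x))|).
Proof.
have [s [sD sM s1 sdet]] := complex_embeddings.
pose N (z : C) : R := ComplexField.Normc.normc z.
have NM z w : N (z * w) = N z * N w by rewrite /N ComplexField.Normc.normcM.
have NC (a : R) : N (a%:C)%C = `|a|.
  by rewrite /N /= expr0n addr0 sqrtr_sqr.
have s0 i : s i 0 = 0 by apply: (@addrI _ (s i 0)); rewrite -sD !addr0.
have snat i (n : nat) : s i n%:R = n%:R.
  by elim: n => [|n IH]; rewrite ?s0 // -!natr1 sD IH s1.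
have Nnat n : N n%:R = n%:R.
  by rewrite -(rmorph_nat (@real_complex R)) NC ger0_norm.
have N0 z : N z = 0 -> z = 0 by exact: ComplexField.Normc.eq0_normc.
exists (fun i x => N (s i x)); split => [i|x].
  split.
  - split; first by rewrite s0 (Nnat 0).
    + move=> x x0; rewrite lt_def; apply/andP; split;
        last by case: (s i x) => a b; exact: sqrtr_ge0.
      apply: contraNneq x0 => /N0 z; have := sM i x x^-1.
      have [->//|x0] := eqVneq x 0.
      by rewrite mulfV // s1 z mul0r => /eqP; rewrite oner_eq0.
    + by move=> x y; rewrite sM NM.
    + by move=> x y; rewrite sD; exact: le_normcD.
    + exists 2%:R; rewrite snat Nnat fext_natr_eq0; split => //.
      by rewrite (eqr_nat R 2 1).
  - move=> /(_ 1 1); rewrite -[1 + 1]/(2%:R) snat s1 Nnat (Nnat 1) maxxx.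
    by rewrite (ler_nat R 2 1).
  - by move=> n; rewrite snat Nnat.
rewrite -(big_morph N NM (Nnat 1)) sdet -(fmorph_rat (@real_complex R)); exact: NC.
Qed.

End Embeddings.

(** * Elements small at every place *)

Lemma expr_unbounded (R : realType) (x c : R) : 1 < x -> exists n, c < x ^+ n.
Proof.
move=> x1; pose h := x - 1; have h0 : 0 < h by rewrite subr_gt0.
have bern n : 1 + h *+ n <= x ^+ n.
  elim: n => [|n IH]; first by rewrite expr0 mulr0n addr0.
  have z0 : 0 <= h *+ n by rewrite mulrn_wge0 // ltW.
  rewrite exprS mulrS; apply: le_trans (ler_wpM2l _ IH); last by rewrite ltW // (lt_trans ltr01).
  move: (h *+ n) z0 => z z0; rewrite (_ : x = 1 + h); last by rewrite addrC subrK.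
  by have := mulr_ge0 (ltW h0) z0; lra.
exists (Num.bound (c / h)); apply: lt_le_trans (bern _).
apply: (@lt_le_trans _ _ (h *+ Num.bound (c / h))); last by rewrite lerDr.
rewrite -mulr_natl -ltr_pdivrMr //; apply: le_lt_trans (ler_norm _) _.
by have := archi_boundP (normr_ge0 (c / h)); rewrite /Num.bound normr_id.
Qed.

Lemma common_denominator (I : finType) (a : I -> rat) :
  exists2 D : nat, (0 < D)%N & forall i, D%:R * a i \is a Num.int.
Proof.
exists (\prod_i `|denq (a i)|%N) => [|i].
  by rewrite prodn_gt0 // => i; rewrite absz_gt0 denq_neq0.
rewrite (bigD1 i) //= natrM mulrC mulrA rpredM //; last exact: natr_int.
rewrite -{1}(divq_num_den (a i)) natr_absz ger0_norm ?denq_ge0 // mulfVK ?intr_eq0 ?denq_neq0 //.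
exact: intr_int.
Qed.

Section SmallEverywhere.
Variables (K : fieldExtType rat).
Local Notation d := (dim K).

(** Integrality reads $y^n = \sum_k c_k y^{n-1-k}$ with integers $c_k$ for large [n], so a
    denominator clearing the first powers clears all of them. *)
Lemma bounded_denominator_powers (y : K) : y != 0 -> adjoin (@intset K) y^-1 y ->
  exists2 D : nat, (0 < D)%N &
    forall n i j, D%:R * regmx (y ^+ n) i j \is a Num.int.
Proof.
move=> y0 [p pZ ep]; set s := size p.
have [D D0 hD] := common_denominator
  (fun t : 'I_s.+1 * 'I_d * 'I_d => regmx (y ^+ t.1.1) t.1.2 t.2).
exists D => // n; elim/ltn_ind: n => n IH i j.
case: (ltnP n s.+1) => ns; first by have := hD (Ordinal ns, i, j).
have /choice[c hc] k : exists c : int, p`_k = c%:~R by have [c ->] := pZ k; exists c.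
have -> : y ^+ n = \sum_(k < s) (c k)%:~R *: y ^+ (n.-1 - k).
  have n0 : (0 < n)%N by apply: leq_trans ns.
  rewrite -{1}(prednK n0) exprS {1}ep horner_coef mulr_suml; apply: eq_bigr => k _.
  have le : (k <= n.-1)%N by have := ltn_ord k; rewrite -/s; move: ns; lia.
  have -> : y ^+ n.-1 = y ^+ (n.-1 - k) * y ^+ k by rewrite -exprD subnK.
  by rewrite exprVn -mulrA [_^-1 * _]mulrCA mulVf ?expf_neq0 // mulr1 hc scaler_int mulrzl.
rewrite regmx_sum summxE mulr_sumr rpred_sum // => k _.
rewrite regmxZ mxE mulrCA rpredM ?intr_int // IH //.
by move: ns; lia.
Qed.

(* The product formula in the form needed: the norm of [y] would be a nonzero
   rational of absolute value less than 1 whose powers have bounded denominator. *)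
Lemma small_everywhere_eq0 (R : realType) : exists s : 'I_d -> K -> R,
  (forall i, [/\ is_absval (s i), ~ ultrametric_absval (s i) &
                 forall n : nat, s i n%:R = n%:R]) /\
  (forall y, (forall f : K -> R, padic_absval (\dim {:K})`! f -> f y <= 1) ->
             (forall i, s i y < 1) -> y = 0).
Proof.
have [s [sabs sdet]] := archimedean_absvals K R; exists s; split => // y h hs.
apply/eqP; apply: contraT => y0.
have [D D0 hD] := bounded_denominator_powers y0 (integral_of_places h).
have nd := det_regmx_neq0 y0; set N := \det _ in nd.
have sge i : 0 < s i y by have [[_ sp _ _ _] _ _] := sabs i; apply: sp.
have d0 : (0 < d)%N.
  by have := adim_gt0 {:K}%AS; rewrite dimvf.
have N1 : `|ratr N| < 1 :> R.
  rewrite -sdet (bigD1 (Ordinal d0)) //=.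
  apply: le_lt_trans (hs (Ordinal d0)); apply: ler_piMr; first exact: ltW.
  by apply: prodr_ile1 => i _; rewrite !ltW.
have Ngt : 0 < `|ratr N| :> R by rewrite normr_gt0 fmorph_eq0.
(* With this [n], $D^d |N|^n < 1$; yet $D^d N^n$ is a nonzero integer, the determinant of the
   integral matrix [D%:R *: regmx (y ^+ n)]. *)
have [|n] := @expr_unbounded R `|ratr N|^-1 (D%:R ^+ d); first by rewrite invf_gt1.
rewrite exprVn => H.
have zint : D%:R ^+ d * N ^+ n \is a Num.int.
  have -> : D%:R ^+ d * N ^+ n = \det (D%:R *: regmx (y ^+ n)).
    rewrite detZ; congr (_ * _); elim: n {H} => [|n IH]; first by rewrite expr0 regmx1 det1.
    by rewrite !exprS regmxM det_mulmx IH.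
  rewrite rpred_sum // => t _; rewrite rpredMsign rpred_prod // => i _.
  by rewrite mxE.
have z0 : D%:R ^+ d * N ^+ n != 0 :> rat.
  by rewrite mulf_neq0 ?expf_neq0 // pnatr_eq0 -lt0n.
have := norm_intr_ge1 zint z0; rewrite -(ler_rat R) rmorph1 ratr_norm rmorphM.
rewrite !rmorphXn /= ratr_nat normrM !normrX normr_nat leNgt => /negP[].
by rewrite -ltr_pdivlMr ?exprn_gt0 // mul1r.
Qed.


End SmallEverywhere.

(** * Calculus of absolute values *)

Section AbsvalTheory.
Variables (K : fieldType) (R : realType) (f : K -> R).
Hypothesis af : is_absval f.

Lemma absval0 : f 0 = 0. Proof. by case: af. Qed.
Lemma absval_gt0 x : x != 0 -> 0 < f x. Proof. by case: af => _ h _ _ _; apply: h. Qed.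
Lemma absval_ge0 x : 0 <= f x.
Proof. by have [->|x0] := eqVneq x 0; [rewrite absval0|apply/ltW/absval_gt0]. Qed.
Lemma absvalM x y : f (x * y) = f x * f y. Proof. by case: af. Qed.
Lemma absvalD x y : f (x + y) <= f x + f y. Proof. by case: af. Qed.
Lemma absval_eq0 x : (f x == 0) = (x == 0).
Proof.
have [->|x0] := eqVneq x 0; first by rewrite absval0 eqxx.
by rewrite gt_eqF // absval_gt0.
Qed.
Lemma absval1 : f 1 = 1.
Proof.
have n0 : f 1 != 0 by rewrite absval_eq0 oner_neq0.
by apply: (mulfI n0); rewrite -absvalM !mulr1.
Qed.
Lemma absvalX x n : f (x ^+ n) = f x ^+ n.
Proof. by elim: n => [|n IH]; rewrite ?absval1 // !exprS absvalM IH. Qed.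
Lemma absvalV x : f x^-1 = (f x)^-1.
Proof.
have [->|x0] := eqVneq x 0; first by rewrite invr0 absval0 invr0.
have n0 : f x != 0 by rewrite absval_eq0.
by apply: (mulfI n0); rewrite -absvalM !mulfV // absval1.
Qed.
Lemma absvalN1 : f (-1) = 1.
Proof.
have : f (-1) ^+ 2 = 1 by rewrite -absvalX sqrrN expr1n absval1.
by move/eqP; rewrite sqrf_eq1 => /orP[/eqP //|/eqP e];
   have := absval_ge0 (-1); rewrite e oppr_ge0 ler10.
Qed.
Lemma absvalN x : f (- x) = f x.
Proof. by rewrite -mulN1r absvalM absvalN1 mul1r. Qed.
Lemma absvalB x y : f (x - y) <= f x + f y.
Proof. by rewrite -(absvalN y) absvalD. Qed.
Lemma absval_sum (I : Type) (r : seq I) (P : pred I) (E : I -> K) :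
  f (\sum_(i <- r | P i) E i) <= \sum_(i <- r | P i) f (E i).
Proof.
elim/big_rec2: _ => [|i y z _ h]; first by rewrite absval0.
by apply: le_trans (absvalD _ _) _; rewrite lerD2l.
Qed.
Lemma absval_prod (I : Type) (r : seq I) (P : pred I) (E : I -> K) :
  f (\prod_(i <- r | P i) E i) = \prod_(i <- r | P i) f (E i).
Proof. exact: (big_morph _ absvalM absval1). Qed.
Lemma absval_sign (b : bool) x : f ((-1) ^+ b * x) = f x.
Proof. by case: b; rewrite ?expr0 ?expr1 ?mulN1r ?mul1r ?absvalN. Qed.

(** Leibniz expansion, with one bound per column because the later Hankel columns become much
    smaller after the change of basis. *)
Lemma absval_det n (A : 'M[K]_n) (r : 'I_n -> R) :
  (forall i j, f (A i j) <= r j) -> f (\det A) <= n`!%:R * \prod_j r j.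
Proof.
move=> h; rewrite -det_tr; apply: le_trans (absval_sum _ _ _) _.
apply: (@le_trans _ _ (\sum_(s : {perm 'I_n}) \prod_j r j)); last first.
  by rewrite sumr_const card_Sn mulr_natl.
apply: ler_sum => s _; rewrite absval_sign absval_prod; apply: ler_prod => i _.
by rewrite absval_ge0 mxE h.
Qed.

Hypothesis uf : ultrametric_absval f.

Lemma ultra_sum (I : Type) (r : seq I) (P : pred I) (E : I -> K) B : 0 <= B ->
  (forall i, P i -> f (E i) <= B) -> f (\sum_(i <- r | P i) E i) <= B.
Proof.
move=> B0 h; elim/big_ind: _ => [|x y hx hy|//]; first by rewrite absval0.
by apply: le_trans (uf _ _) _; rewrite ge_max hx hy.
Qed.

Lemma ultra_det n (A : 'M[K]_n) : (forall i j, f (A i j) <= 1) -> f (\det A) <= 1.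
Proof.
move=> h; apply: ultra_sum => // s _; rewrite absval_sign absval_prod.
by apply: prodr_ile1 => i _; rewrite absval_ge0 h.
Qed.

Lemma ultra_nat n : f n%:R <= 1.
Proof.
elim: n => [|n IH]; first by rewrite absval0.
by rewrite -natr1; apply: le_trans (uf _ _) _; rewrite ge_max IH absval1 /=.
Qed.

End AbsvalTheory.

(** * Powers of $q$ gained by iterating the recurrence *)

Section Gain.
Variables (F : fieldType) (q c : F) (m : nat) (b x : 'I_m -> F) (u : nat -> F).
Hypotheses (q0 : q != 0) (c0 : c != 0).
Hypothesis rec : forall n,
  u n.+1 = c * (1 - q ^+ n.+1) * u n + \sum_i b i * x i ^+ n.+1.

Let P := \prod_i ('X - (x i)%:P).
Let G := P * ('X - c%:P).

(** ['X - c%:P] removes $c u_n$ from the recurrence and [P] kills the geometric terms, so only the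
    term $-c q^{n+1} u_n$ survives; moving the twist through [P] dilates it. *)
Let actG n : act G u n = q ^+ n * act (- (c * q) *: dilate q P) u n.
Proof.
rewrite /G actM actZ mulrCA -act_twist.
have -> : act P (act ('X - c%:P) u) n = act P (fun k => - (c * q) * (q ^+ k * u k)
    + \sum_i b i * x i * x i ^+ k) n.
  apply: act_ext => k; rewrite -polyCN actD actC -['X]mul1r actMX -[1]/(1%:P) actC.
  rewrite mul1r rec.
  under [X in _ = _ + X]eq_bigr => i _ do rewrite -mulrA -exprS.
  by rewrite exprS; ring.
rewrite act_add act_mul act_sum big1 ?addr0 // => i _.
rewrite (act_mul P (b i * x i) (fun k => x i ^+ k)) act_geometric.
by rewrite /P horner_prod (bigD1 i) //= hornerXsubC subrr !mul0r mulr0.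
Qed.

(* Each application of [G] trades for a factor [q ^+ n]: at a place where
   [|q| > 1] the combination [act W u n] is smaller by [|q| ^- (k * n)]. *)
Lemma recurrence_gain (k : nat) : exists A W : {poly F}, W \is monic /\
  forall n, act A u n = q ^+ (k * n) * act W u n.
Proof.
suff [A [W [W0 h]]] : exists A W : {poly F}, W != 0 /\
    forall n, act A u n = q ^+ (k * n) * act W u n.
  exists ((lead_coef W)^-1 *: A), ((lead_coef W)^-1 *: W); split.
    by rewrite monicE lead_coefZ mulVf // lead_coef_eq0.
  by move=> n; rewrite !actZ h mulrCA.
elim: k => [|k [A [W [W0 h]]]].
  by exists 1, 1; split => [|n]; rewrite ?oner_neq0 // mul0n mul1r.
have qk0 : q ^+ k != 0 by rewrite expf_neq0.
have G0 : dilate q P != 0.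
  by rewrite dilate_eq0 // monic_neq0 // monic_prod_XsubC.
(* Dilating [G] by $q^{-k}$ compensates the twist $q^{kn}$ already gained; commuting [G] past [W]
   and applying [actG] gains one more $q^n$. *)
exists (dilate (q ^- k) G * A), (dilate q W * (- (c * q) *: dilate q P)); split.
  by rewrite mulf_neq0 ?dilate_eq0 // scaler_eq0 negb_or G0 oppr_eq0 !mulf_neq0.
move=> n; rewrite !actM.
have -> : act (dilate (q ^- k) G) (act A u) n =
    act (dilate (q ^- k) G) (fun j => (q ^+ k) ^+ j * act W u j) n.
  by apply: act_ext => j; rewrite h exprM.
rewrite act_twist.
have -> : dilate (q ^+ k) (dilate (q ^- k) G) = G.
  by apply/polyP => i; rewrite !coef_dilate -mulrA -exprMn mulVf // expr1n mulr1.
rewrite -actM [G * W]mulrC actM (act_ext _ _ actG) act_twist mulSn exprD exprM.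
by rewrite mulrCA mulrA.
Qed.

End Gain.

(** * Hankel determinants at places with $|q| > 1$ *)

Lemma actMXn (F : fieldType) (p : {poly F}) u k n :
  act (p * 'X^k) u n = act p u (n + k).
Proof.
elim: k n => [|k IH] n; first by rewrite mulr1 addn0.
by rewrite exprSr mulrA actMX IH addSnnS.
Qed.

(* A unitriangular change of basis on the columns. *)
Lemma det_hankel_monic (F : fieldType) (u : nat -> F) (W : {poly F}) (w N : nat) :
  W \is monic -> size W = w.+1 ->
  \det (hankel u N) = \det (\matrix_(i < N, j < N)
     (if (j < w)%N then u (i + j)%N else act W u (i + (j - w))%N)).
Proof.
move=> mW sW.
pose e (j : nat) : {poly F} := if (j < w)%N then 'X^j else W * 'X^(j - w).
have se j : size (e j) = j.+1.
  rewrite /e; case: ltnP => [_|wj]; first by rewrite size_polyXn.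
  by rewrite size_mulXn ?monic_neq0 // sW addnS subnK.
have me j : (e j)`_j = 1.
  rewrite /e; case: ltnP => [_|wj]; first by rewrite coefXn eqxx.
  rewrite coefMXn ltnNge leq_subr /= subKn //.
  by have := monicP mW; rewrite /lead_coef sW.
pose T : 'M[F]_N := \matrix_(k, j) (e j)`_k.
have dT : \det T = 1.
  rewrite -det_tr det_trig; first by rewrite big1 // => i _; rewrite !mxE me.
  apply/is_trig_mxP => i j ij; rewrite !mxE nth_default // se.
  exact: ij.
rewrite -[LHS]mulr1 -dT -det_mulmx; congr (\det _); apply/matrixP => i j; rewrite !mxE.
have -> : (if (j < w)%N then u (i + j)%N else act W u (i + (j - w))%N) = act (e j) u i.
  rewrite /e; case: ltnP => _; rewrite ?actMXn //.
  by rewrite -['X^j]mul1r actMXn -[1]/(1%:P) actC mul1r.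
rewrite (@act_widen _ (e j) _ _ N) ?se //; apply: eq_bigr => k _.
by rewrite !mxE mulrC addnC.
Qed.

Section UniformClass.
Variables (K : fieldType) (R : realType) (q : K) (F : set (K -> R)).

(** Every constant is bounded by a power of $|q|$ whose exponent does not depend on the place, so
    one threshold serves infinitely many p-adic places at once. *)
Definition uniform_class :=
  [/\ forall f, F f -> is_absval f, forall f, F f -> 1 < f q,
      exists e, forall f, F f -> 2 <= f q ^+ e
    & forall x, exists e, forall f, F f -> f x <= f q ^+ e].

Hypothesis uF : uniform_class.

Let aF f : F f -> is_absval f. Proof. by case: uF => h _ _ _; apply: h. Qed.
Let qF f : F f -> 1 < f q. Proof. by case: uF => _ h _ _; apply: h. Qed.

Lemma uniform_mono f a b : F f -> (a <= b)%N -> f q ^+ a <= f q ^+ b.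
Proof. by move=> Ff ab; rewrite ler_eXn2l // qF. Qed.

Lemma uniform_nat : exists e, forall f n, F f -> n%:R <= f q ^+ (e * n).
Proof.
case: uF => _ _ [e he] _; exists e => f n Ff.
apply: (@le_trans _ _ (2 ^+ n)); first by rewrite -natrX ler_nat ltnW // ltn_expl.
by rewrite exprM lerXn2r ?nnegrE // ?he // exprn_ge0 // ltW // (lt_trans ltr01) // qF.
Qed.

Lemma uniform_family (I : finType) (a : I -> K) :
  exists e, forall f i, F f -> f (a i) <= f q ^+ e.
Proof.
have [_ _ _ h] := uF.
have /choice[e he] (i : I) := h (a i).
exists (\sum_i e i)%N => f i Ff; apply: le_trans (he i f Ff) _.
by apply: uniform_mono => //; rewrite (bigD1 i) //= leq_addr.
Qed.

Section Hankel.
Variables (u : nat -> K) (E : nat).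
Hypothesis uE : forall f n, F f -> f (u n) <= f q ^+ (E * n.+1).
Hypothesis gain : forall k, exists A W : {poly K}, W \is monic /\
  forall n, act A u n = q ^+ (k * n) * act W u n.

Lemma uniform_act (p : {poly K}) :
  exists e, forall f n, F f -> f (act p u n) <= f q ^+ (e + E * n).
Proof.
have [e0 h0] := uniform_nat.
have [e1 h1] := uniform_family (fun i : 'I_(size p) => p`_i).
exists (e0 * size p + (e1 + E * (size p).+1))%N => f n Ff.
apply: le_trans (absval_sum (aF Ff) _ _ _) _.
apply: (@le_trans _ _ (\sum_(i < size p) f q ^+ (e1 + E * (size p).+1 + E * n))).
  apply: ler_sum => i _; rewrite (absvalM (aF Ff)).
  apply: le_trans (ler_pM (absval_ge0 (aF Ff) _) (absval_ge0 (aF Ff) _)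
     (h1 _ i Ff) (uE _ Ff)) _.
  rewrite -exprD uniform_mono // -addnA leq_add2l -mulnDr leq_mul2l.
  by apply/orP; right; have := ltn_ord i; lia.
rewrite sumr_const card_ord -mulr_natl -[X in _ <= f q ^+ X]addnA [X in _ <= X]exprD.
rewrite ler_wpM2r ?h0 //.
by rewrite exprn_ge0 // ltW // (lt_trans ltr01) // qF.
Qed.

Lemma sum_subn_ge w N : (N ^ 2 <= 2 * (\sum_(j < N) (j - w)) + 2 * w * N + N)%N.
Proof.
elim: N => [|N IH]; first by rewrite big_ord0.
by rewrite big_ord_recr /=; move: (\sum_(j < N) _)%N IH => s; nia.
Qed.

(** After [det_hankel_monic], column $j \ge w$ is at most $|q|^{a - g(j-w)}$; the product over
    columns has order $|q|^{-gN^2/2}$, up to exponents linear in [N]. *)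
Lemma hankel_small (M : nat) : exists N0, forall N f, (N0 <= N)%N -> F f ->
  f (\det (hankel u N)) * f q ^+ (M * N ^ 2) < 1.
Proof.
have [e he] := uniform_nat.
(* The columns gain $gN^2/2$, which must exceed the cost $eN^2$ of $N!$ plus the target $MN^2$. *)
have [g gE] : exists g, (g = 2 * (e + M).+1)%N by exists (2 * (e + M).+1)%N.
(* The extra [E] cancels the growth $|q|^{En}$ of [act A u]. *)
have [A [W [mW hW]]] := gain (g + E).
have [a ha] := uniform_act A.
pose w := (size W).-1.
have sW : size W = w.+1 by rewrite prednK // size_poly_gt0 monic_neq0.
exists ((e + M).+1 * (2 * w + 1) + a + 2 * E * w).+1 => N f leN Ff.
have af := aF Ff; have q1 := qF Ff; set Q := f q in q1 *.
have Q0 : 0 < Q by rewrite (lt_trans ltr01).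
have QX k : 0 < Q ^+ k by rewrite exprn_gt0.
have Wb n : f (act W u n) * Q ^+ (g * n) <= Q ^+ a.
  have := ha f n Ff; rewrite hW absvalM // absvalX // mulnDl -/Q !exprD => h.
  rewrite -(ler_pM2r (QX (E * n)%N)); apply: le_trans h.
  by rewrite le_eqVlt; apply/orP; left; apply/eqP; ring.
(* The first [w] columns are unchanged and only obey the growth bound, with $i + j + 1 \le 2N$. *)
pose x (j : 'I_N) := (a + (j < w) * (2 * E * N))%N.
have dU : f (\det (hankel u N)) <= N`!%:R * \prod_(j < N) (Q ^+ x j / Q ^+ (g * (j - w))).
  rewrite (det_hankel_monic _ _ mW sW); apply: absval_det => // i j.
  rewrite mxE /x ler_pdivlMr //; case: ltnP => jw.
    have -> : (j - w = 0)%N by apply/eqP; rewrite subn_eq0 ltnW.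
    rewrite muln0 mulr1 mul1n; apply: le_trans (uE _ Ff) _.
    rewrite -/Q ler_eXn2l //; have := ltn_ord i; have := ltn_ord j; move=> h1 h2.
    have h : ((i + j).+1 <= 2 * N)%N by lia.
    apply: leq_trans (leq_mul (leqnn E) h) _.
    by rewrite mulnA [(E * 2)%N]mulnC leq_addl.
  rewrite mul0n addn0; apply: le_trans (Wb (i + (j - w))%N).
  rewrite ler_wpM2l ?absval_ge0 // ler_eXn2l // leq_mul2l leq_addl.
  by rewrite orbT.
rewrite big_split /= in dU.
set s := (\sum_(j < N) (j - w))%N.
have e1 : \prod_(j < N) (Q ^+ (g * (j - w)))^-1 = (Q ^+ (g * s))^-1.
  by rewrite prodfV -expr_sum big_distrr.
have e2 : \prod_(j < N) Q ^+ x j <= Q ^+ (a * N + 2 * E * N * w).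
  rewrite -expr_sum ler_eXn2l // /x big_split /= sum_nat_const card_ord mulnC.
  rewrite leq_add2l -big_distrl /= mulnC leq_mul2l; apply/orP; right.
  suff -> : (\sum_(j < N) (j < w) = minn N w)%N by exact: geq_minr.
  elim: (N) => [|n IH]; first by rewrite big_ord0 min0n.
  by rewrite big_ord_recr /= IH; case: ltnP; lia.
have fac : N`!%:R <= Q ^+ (e * N ^ 2).
  apply: (@le_trans _ _ (N%:R ^+ N)).
    rewrite -natrX ler_nat fact_prod; apply: leq_trans (_ : \prod_(1 <= i < N.+1) N <= _)%N.
      by rewrite !big_nat; apply: leq_prod => i /andP[_]; rewrite ltnS.
    by rewrite prod_nat_const_nat subn1.
  rewrite -mulnn mulnA exprM; apply: lerXn2r; rewrite ?nnegrE ?ler0n //.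
    exact: ltW (QX _).
  exact: (he _ _ Ff).
apply: (@le_lt_trans _ _ (Q ^+ (e * N ^ 2 + (a * N + 2 * E * N * w) + M * N ^ 2) / Q ^+ (g * s))).
  rewrite exprD mulrAC ler_wpM2r ?(ltW (QX _)) //; apply: le_trans dU _.
  rewrite e1 mulrA ler_pM2r ?invr_gt0 // exprD.
  by apply: ler_pM => //; apply: prodr_ge0 => j _; rewrite ltW.
rewrite ltr_pdivrMr // mul1r ltr_eXn2l //.
have := sum_subn_ge w N; rewrite -/s gE.
by move: leN; nia.
Qed.

End Hankel.
End UniformClass.

(** * The sequence of partial sums and its growth *)

Section QSequence.
Variables (K : fieldType) (q : K).
Hypothesis qX : forall k, q ^+ k.+1 != 1.

Let q1 : 1 - q != 0.
Proof. by rewrite subr_eq0 eq_sym; exact: (qX 0). Qed.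

Lemma qnum_neq0 n : qnum q n.+1 != 0.
Proof. by rewrite mulf_neq0 ?invr_eq0 // subr_eq0 eq_sym. Qed.

Lemma qfactS n : qfact q n.+1 = qfact q n * qnum q n.+1.
Proof. by rewrite /qfact big_nat_recr. Qed.

Lemma qfact_neq0 n : qfact q n != 0.
Proof.
elim: n => [|n IH]; first by rewrite /qfact big_geq // oner_neq0.
by rewrite qfactS mulf_neq0 // qnum_neq0.
Qed.

Lemma Eq_partialS z N : Eq_partial q z N.+1 = Eq_partial q z N + z ^+ N / qfact q N.
Proof. by rewrite /Eq_partial big_ord_recr. Qed.

Section Linear.
Variables (m : nat) (b0 : K) (b x : 'I_m -> K).

Definition qsum N := b0 + \sum_i b i * Eq_partial q (x i) N.

(** [qsum n.+1] has terms up to degree [n], so [qfact q n] clears exactly its q-factorials. *)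
Definition qseq n := qfact q n * qsum n.+1.

Lemma qsumS N : qsum N.+1 = qsum N + \sum_i b i * (x i ^+ N / qfact q N).
Proof.
rewrite /qsum -addrA -big_split /=; congr (_ + _); apply: eq_bigr => i _.
by rewrite Eq_partialS mulrDr.
Qed.

Lemma qseq_rec n :
  qseq n.+1 = qnum q n.+1 * qseq n + \sum_i b i * x i ^+ n.+1.
Proof.
rewrite /qseq [in LHS]qsumS mulrDr; congr (_ + _).
  by rewrite qfactS; ring.
rewrite mulr_sumr; apply: eq_bigr => i _.
by rewrite mulrCA; congr (_ * _); rewrite mulrC mulfVK // qfact_neq0.
Qed.

Lemma qseq_recE n :
  qseq n.+1 = (1 - q)^-1 * (1 - q ^+ n.+1) * qseq n + \sum_i b i * x i ^+ n.+1.
Proof. by rewrite qseq_rec /qnum [_ / (1 - q)]mulrC. Qed.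

End Linear.

Section Tail.
Variables (R : realType) (F : set (K -> R)).
Hypothesis uF : uniform_class q F.

Let aF f : F f -> is_absval f. Proof. by case: uF => h _ _ _; apply: h. Qed.
Let qF f : F f -> 1 < f q. Proof. by case: uF => _ h _ _; apply: h. Qed.

Lemma qnum_large (x : K) :
  exists L, forall f l, F f -> (L <= l)%N -> 2 * f x <= f (qnum q l.+1).
Proof.
have [_ _ [e he] hx] := uF.
have [e1 h1] := hx x; have [e2 h2] := hx (1 - q).
(* [e1] and [e2] bound [x] and [1 - q]; [e + e] gives a factor 4, of which 2 is claimed and the rest
   pays for the loss of 1 in $|1 - q^{l+1}| \ge |q|^{l+1} - 1$. *)
exists (e1 + e2 + (e + e))%N => f l Ff ll.
have af := aF Ff; set Q := f q.
have Q1 : 1 < Q := qF Ff.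
have f1q : 0 < f (1 - q) by rewrite absval_gt0.
have nE : f (qnum q l.+1) * f (1 - q) = f (1 - q ^+ l.+1).
  by rewrite -absvalM // /qnum mulfVK.
rewrite -(ler_pM2r f1q) nE.
have lb : Q ^+ l.+1 - 1 <= f (1 - q ^+ l.+1).
  have := absvalB af 1 (1 - q ^+ l.+1); rewrite subKr absval1 // absvalX // -/Q.
  by rewrite lerBlDl.
apply: le_trans lb.
have {}he := he f Ff; have {}h1 := h1 f Ff; have {}h2 := h2 f Ff; rewrite -/Q in he h1 h2.
have big : Q ^+ e1 * Q ^+ e2 * (Q ^+ e * Q ^+ e) <= Q ^+ l.+1.
  by rewrite -!exprD ler_eXn2l // ltnW.
have ge1 k : 1 <= Q ^+ k by rewrite exprn_ege1 // ltW.
have ab1 : 1 <= Q ^+ e1 * Q ^+ e2 by rewrite -exprD.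
have cc : 4 <= Q ^+ e * Q ^+ e by nra.
have fab : f x * f (1 - q) <= Q ^+ e1 * Q ^+ e2 by rewrite ler_pM // absval_ge0.
have := ler_wpM2l (le_trans ler01 ab1) cc.
rewrite -[2 * f x * _]mulrA; lra.
Qed.

Section Bound.
Variables (m : nat) (b0 : K) (b x : 'I_m -> K).
Local Notation S := (qsum b0 b x).
Local Notation u := (qseq b0 b x).
Hypothesis S0 : forall f, F f -> ((fun N => f (S N)) @ \oo --> (0 : R))%classic.

(** Since the sums tend to 0, $u_n$ is minus $n_q!$ times the tail of the series. Beyond a threshold
    common to all places the tail is dominated by a geometric series of ratio $1/2$, so $|u_n| \le
    \sum_i |b_i| |x_i|^n$; finitely many earlier terms remain. *)
Lemma qseq_uniform : exists E, forall f n, F f -> f (u n) <= f q ^+ (E * n.+1).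
Proof.
have /choice[L hL] (i : 'I_m) := qnum_large (x i).
pose L0 := (\sum_i L i)%N.
have [e he] := uniform_nat uF.
have [e1 h1] := uniform_family uF b.
have [e2 h2] := uniform_family uF x.
have [e3 h3] := uniform_family uF (fun n : 'I_L0 => u n).
exists (e3 + (e * m + e1 + e2))%N => f n Ff.
have af := aF Ff; set Q := f q; have Q1 : 1 < Q := qF Ff.
have Q0 : 0 < Q by rewrite (lt_trans ltr01).
case: (ltnP n L0) => nL.
  apply: le_trans (h3 f (Ordinal nL) Ff) _; rewrite -/Q ler_eXn2l //; nia.
pose B := \sum_i f (b i) * f (x i) ^+ n.
have B0 : 0 <= B by apply: sumr_ge0 => i _; rewrite mulr_ge0 ?exprn_ge0 // absval_ge0.
have term i k : f (x i ^+ (n + k) * (qfact q n / qfact q (n + k))) <= f (x i) ^+ n / 2 ^+ k.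
  elim: k => [|k IH]; first by rewrite addn0 expr0 divr1 mulfV ?qfact_neq0 // mulr1 absvalX.
  have lk : (L i <= n + k)%N.
    by apply: leq_trans (leq_addr k _); apply: leq_trans nL; rewrite /L0 (bigD1 i) //= leq_addr.
  have nq := qnum_neq0 (n + k); have nf := qfact_neq0 (n + k).
  have -> : x i ^+ (n + k.+1) * (qfact q n / qfact q (n + k.+1)) =
      x i ^+ (n + k) * (qfact q n / qfact q (n + k)) * (x i / qnum q (n + k).+1).
    by rewrite addnS qfactS exprSr; field; rewrite nq nf.
  rewrite absvalM // exprSr [(2 ^+ k * 2)^-1]invfM [f (x i) ^+ n * _]mulrA.
  apply: ler_pM => //; rewrite ?absval_ge0 //.
  rewrite absvalM // absvalV // ler_pdivrMr ?absval_gt0 //.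
  by have := hL i f _ Ff lk; lra.
(* The first [k] terms of the tail contribute at most $B(1/2 + \dots + 2^{-k}) = B(1 - 2^{-k})$. *)
have part k : f (u n) <= f (qfact q n * S (n.+1 + k)) + B * (1 - (2 ^+ k)^-1).
  elim: k => [|k IH]; first by rewrite addn0 expr0 invr1 subrr mulr0 addr0.
  apply: le_trans IH _.
  have -> : qfact q n * S (n.+1 + k) = qfact q n * S (n.+1 + k.+1) -
      \sum_i b i * (x i ^+ (n + k.+1) * (qfact q n / qfact q (n + k.+1))).
    rewrite [(n.+1 + k.+1)%N]addnS qsumS addSnnS [X in _ = X - _]mulrDr.
    rewrite [X in _ = _ + X - _]mulr_sumr.
    under [X in _ = _ + X - _]eq_bigr => i _ do rewrite mulrCA [qfact q n * _]mulrCA.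
    by rewrite addrK.
  apply: le_trans (lerD (absvalB af _ _) (lexx _)) _; rewrite -addrA lerD2l.
  have -> : B * (1 - (2 ^+ k.+1)^-1) = B / 2 ^+ k.+1 + B * (1 - (2 ^+ k)^-1).
    by rewrite exprS invfM; field; rewrite expf_neq0.
  rewrite lerD2r; apply: le_trans (absval_sum af _ _ _) _.
  rewrite mulr_suml; apply: ler_sum => i _; rewrite absvalM // -mulrA ler_wpM2l //.
  exact: absval_ge0.
(* The speed at which the sums tend to 0 may depend on [f], but it disappears from the limiting
   bound. *)
have uB : f (u n) <= B.
  apply/ler_addgt0Pr => eps eps0.
  have g0 : 0 < f (qfact q n) by rewrite absval_gt0 // qfact_neq0.
  have /cvgrPdist_lt/(_ (eps / f (qfact q n)))[] := S0 Ff; first by rewrite divr_gt0.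
  move=> N _ hN; have := hN (n.+1 + N)%N (leq_addl _ _).
  rewrite /= sub0r normrN ger0_norm ?absval_ge0 // ltr_pdivlMr // mulrC -absvalM // => small.
  apply: le_trans (part N) _; rewrite addrC lerD ?(ltW small) //.
  by rewrite ler_piMr // lerBlDl lerDr invr_ge0 exprn_ge0.
apply: le_trans uB _.
apply: (@le_trans _ _ (\sum_(i < m) Q ^+ (e1 + e2 * n))).
  apply: ler_sum => i _; rewrite exprD exprM ler_pM ?exprn_ge0 ?absval_ge0 ?h1 //.
  apply: lerXn2r; [by rewrite nnegrE absval_ge0|by rewrite nnegrE exprn_ge0 // ltW|].
  exact: (h2 _ _ Ff).
rewrite sumr_const card_ord -mulr_natl.
apply: (@le_trans _ _ (Q ^+ (e * m) * Q ^+ (e1 + e2 * n))).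
  by apply: ler_wpM2r (he _ _ Ff); rewrite exprn_ge0 // ltW.
by rewrite -exprD ler_eXn2l //; nia.
Qed.

End Bound.

End Tail.
End QSequence.

(** * Zeros of the q-exponential *)

Lemma cvg0_halving (R : realType) (a : nat -> R) (L : nat) :
  (forall n, 0 <= a n) -> (forall n, (L <= n)%N -> 2 * a n.+1 <= a n) ->
  (a @ \oo --> (0 : R))%classic.
Proof.
move=> a0 h.
have geo k : 2 ^+ k * a (L + k)%N <= a L.
  elim: k => [|k IH]; first by rewrite mul1r addn0.
  apply: le_trans IH; rewrite exprSr -mulrA ler_pM2l ?exprn_gt0 // addnS.
  by apply: h; apply: leq_addr.
apply/cvgrPdist_lt => eps eps0.
have [|k hk] := @expr_unbounded R 2 (a L / eps); first by rewrite ltr1n.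
exists (L + k)%N => // n /= le; rewrite sub0r normrN ger0_norm //.
have [j ->] : exists j, n = (L + (k + j))%N by exists (n - (L + k))%N; lia.
have p0 : 0 < 2 ^+ (k + j) :> R by rewrite exprn_gt0.
rewrite -(ltr_pM2l p0); apply: le_lt_trans (geo _) _.
rewrite -ltr_pdivrMr //; apply: lt_le_trans hk _.
by rewrite ler_eXn2l ?leq_addr // ltr1n.
Qed.

Lemma uniform_class1 (K : fieldType) (R : realType) (q : K) (f : K -> R) :
  is_absval f -> 1 < f q -> uniform_class q [set g | g = f].
Proof.
move=> af q1; split; [by move=> _ ->|by move=> _ ->| |].
  by have [e /ltW he] := expr_unbounded 2 q1; exists e => _ ->.
by move=> x; have [e /ltW he] := expr_unbounded (f x) q1; exists e => _ ->.
Qed.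

Section VanishingExponential.
Variables (K : fieldType) (R : realType) (q : K) (f : K -> R).
Hypothesis qX : forall k, q ^+ k.+1 != 1.
Hypotheses (af : is_absval f) (fq : 1 < f q).

Let q1 : 1 - q != 0.
Proof. by rewrite subr_eq0 eq_sym; exact: (qX 0). Qed.

(** Truncated form of the functional equation $E_q(qz) = (1 + (q-1)z) E_q(z)$. *)
Lemma Eq_partial_mulq z N : Eq_partial q (q * z) N.+1 =
  Eq_partial q z N.+1 + (q - 1) * z * Eq_partial q z N.
Proof.
elim: N => [|N IH]; first by rewrite /Eq_partial !big_ord1 big_ord0 !expr0 mulr0 addr0.
rewrite (Eq_partialS q (q * z)) IH (Eq_partialS q z N.+1) (Eq_partialS q z N).
have nf := qfact_neq0 qX N; have n1 : 1 - q ^+ N.+1 != 0 by rewrite subr_eq0 eq_sym.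
have -> : (q * z) ^+ N.+1 / qfact q N.+1 = z ^+ N.+1 / qfact q N.+1 +
    (q - 1) * z * (z ^+ N / qfact q N); last by ring.
rewrite (qfactS q) /qnum exprMn [z ^+ N.+1]exprS.
move: n1; move: (q ^+ N.+1) => Q n1; field.
by rewrite q1 nf n1.
Qed.

(* [q ^+ t.+1 / (1 - q)] is a zero of [1 + (q - 1) z / q ^+ t.+1], one of the
   factors in the product expansion of the q-exponential. *)
Lemma Eq_partial_cvg0 t :
  ((fun N => f (Eq_partial q ((1 - q)^-1 * q ^+ t.+1) N)) @ \oo --> (0 : R))%classic.
Proof.
have qc : (q - 1) * (1 - q)^-1 = -1 by rewrite -opprB mulNr mulfV.
elim: t => [|t IH]; rewrite -cvg_shiftS /=.
  (* At $z = 1/(1-q)$ the factor $1 + (q-1)z$ vanishes, and the truncated equation leaves only the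
     last term of the partial sum at [z]. *)
  have -> : (fun N => f (Eq_partial q ((1 - q)^-1 * q ^+ 1) N.+1)) =
      (fun N => f ((1 - q)^-1 ^+ N / qfact q N)).
    apply/funext => N; congr (f _); rewrite mulrC Eq_partial_mulq qc Eq_partialS.
    by rewrite mulN1r addrAC subrr add0r.
  have [L hL] := qnum_large qX (uniform_class1 af fq) (1 - q)^-1.
  apply: (@cvg0_halving _ _ L) => [n|n Ln]; first exact: absval_ge0.
  have nq := qnum_neq0 qX n; have nf := qfact_neq0 qX n.
  have -> : (1 - q)^-1 ^+ n.+1 / qfact q n.+1 =
      (1 - q)^-1 ^+ n / qfact q n * ((1 - q)^-1 / qnum q n.+1).
    by rewrite qfactS exprS invfM; ring.
  rewrite (absvalM af) mulrCA ler_piMr ?absval_ge0 // (absvalM af) (absvalV af (qnum _ _)).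
  by rewrite mulrA ler_pdivrMr ?absval_gt0 // mul1r hL.
pose z := (1 - q)^-1 * q ^+ t.+1; rewrite -/z in IH.
have E N : Eq_partial q ((1 - q)^-1 * q ^+ t.+2) N.+1 =
    Eq_partial q z N.+1 - q ^+ t.+1 * Eq_partial q z N.
  by rewrite exprS mulrCA Eq_partial_mulq /z mulrA qc mulN1r mulNr.
have c0 : ((fun N => f (Eq_partial q z N.+1) + f q ^+ t.+1 * f (Eq_partial q z N))
    @ \oo --> (0 : R))%classic.
  rewrite -[X in (_ --> X)%classic]addr0; apply: cvgD.
    by rewrite (cvg_shiftS (fun N => f (Eq_partial q z N))).
  by rewrite -[X in (_ --> X)%classic](mulr0 (f q ^+ t.+1)); apply: cvgMr.
apply: (@squeeze_cvgr _ _ _ _ (cst 0) _ _ _ _ _ c0); last exact: cvg_cst.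
apply: nearW => N; rewrite absval_ge0 //= E.
by apply: le_trans (absvalB af _ _) _; rewrite absvalM // absvalX.
Qed.

End VanishingExponential.

(** * Estimates at ultrametric places and at places with $|q| < 1$ *)

Section Integrality.
Variables (K : fieldExtType rat) (R : realType).

Lemma ultra_int (f : K -> R) (a : int) : is_absval f -> ultrametric_absval f ->
  f a%:~R <= 1.
Proof.
move=> af uf; case: a => n; first exact: ultra_nat.
by rewrite NegzE mulrNz absvalN //; exact: ultra_nat.
Qed.

(** With [a] the leading coefficient of an integer relation for [x], $|ax| > 1$ would force $|x| \ge
    1$ and make the leading term larger than all others. *)
Lemma integral_multiple (x : K) : exists2 D : nat, (0 < D)%N &
  forall f : K -> R, is_absval f -> ultrametric_absval f -> f (D%:R * x) <= 1.
Proof.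
have [P [P0 _ e]] := int_relation x.
have sP : (0 < size P)%N by rewrite size_poly_gt0.
pose n := (size P).-1; have sn : size P = n.+1 by rewrite prednK.
pose a := P`_n.
have a0 : a != 0 by rewrite /a -[n]/((size P).-1) -/(lead_coef P) lead_coef_eq0.
exists `|a|%N => [|f af uf]; first by rewrite absz_gt0.
have fa : f (`|a|%N%:R) = f a%:~R.
  by case: (a) => k //; rewrite NegzE mulrNz absvalN.
have fa0 : 0 < f a%:~R by rewrite absval_gt0 // fext_intr_eq0.
rewrite absvalM // fa leNgt; apply/negP => gt1.
have fx1 : 1 <= f x.
  apply/ltW/(lt_le_trans gt1); rewrite ler_piMl ?absval_ge0 //; exact: ultra_int.
move: e; rewrite sn big_ord_recr /= => /eqP; rewrite addrC addr_eq0 => /eqP e.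
have n0 : (0 < n)%N.
  case: (posnP n) => // z; move/eqP: e; rewrite big1 => [|[k]]; last by rewrite z.
  by rewrite oppr0 mulf_eq0 fext_intr_eq0 (negPf a0) /= z expr0 oner_eq0.
have : f a%:~R * f x ^+ n <= f x ^+ n.-1.
  rewrite -absvalX // -absvalM // e absvalN //.
  apply: ultra_sum => // [|i _]; first by rewrite exprn_ge0 // absval_ge0.
  rewrite absvalM // absvalX //; apply: (@le_trans _ _ (1 * f x ^+ i)).
    by rewrite ler_wpM2r ?exprn_ge0 ?absval_ge0 //; exact: ultra_int.
  by rewrite mul1r ler_weXn2l // -ltnS prednK.
rewrite -{1}(prednK n0) exprS mulrA leNgt => /negP[].
by rewrite ltr_pMl // exprn_gt0 // (lt_le_trans ltr01).
Qed.

Lemma integral_multiples (I : finType) (x : I -> K) : exists2 D : nat, (0 < D)%N &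
  forall (f : K -> R) i, is_absval f -> ultrametric_absval f -> f (D%:R * x i) <= 1.
Proof.
have /choice[D hD] i : exists D : nat, (0 < D)%N /\ forall f : K -> R,
    is_absval f -> ultrametric_absval f -> f (D%:R * x i) <= 1.
  by have [D D0 h] := integral_multiple (x i); exists D.
exists (\prod_i D i)%N => [|f i af uf].
  by rewrite prodn_gt0 // => i; have [] := hD i.
rewrite (bigD1 i) //= natrM mulrAC absvalM // mulr_ile1 ?absval_ge0 //.
  by have [_] := hD i; apply.
exact: ultra_nat.
Qed.

(** $|q|^e$ is a power of [p] greater than 1, hence at least [p]. If $Dx$ is integral, then $|x| \le
    |D|^{-1} \le p^D \le |q|^{eD}$. *)
Lemma padic_uniform (q : K) (e : nat) : (0 < e)%N ->
  uniform_class q [set f : K -> R | padic_absval e f /\ 1 < f q].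
Proof.
move=> e0; have qe (f : K -> R) p : 1 < f q -> is_absval f -> prime p ->
    (forall x, x != 0 -> exists k : int, f x ^+ e = p%:R ^ k) -> p%:R <= f q ^+ e.
  move=> q1 af pp hk.
  have q0 : q != 0 by apply: contraTneq q1 => ->; rewrite absval0 // ltr10.
  have p1 : 1 < p%:R :> R by rewrite ltr1n prime_gt1.
  have [k ek] := hk _ q0.
  have : 1 < f q ^+ e by rewrite exprn_egt1 // -lt0n.
  rewrite ek; have := ltr_eXz2l p1 0 k; rewrite expr0z => ->.
  by case: k ek => [[|k]|k] // ek _; rewrite -exprnP exprS ler_peMr ?ler0n // exprn_ege1 // ltW.
split; [by move=> f [[]]|by move=> f []| |].
  exists e => f [[af uf [p pp [_ hk]]] q1].
  by apply: le_trans (qe f p q1 af pp hk); rewrite ler_nat prime_gt1.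
move=> x; have [D D0 hD] := integral_multiple x.
exists (e * D)%N => f [[af uf [p pp [hn hk]]] q1].
have := hD f af uf; rewrite absvalM // hn // mulrC ler_pdivrMr ?mul1r; last first.
  by rewrite exprn_gt0 // ltr0n prime_gt0.
move/le_trans; apply; rewrite exprM.
apply: (@le_trans _ _ (p%:R ^+ D)).
  rewrite ler_weXn2l ?ler1n ?prime_gt0 //.
  by apply: leq_trans (ltnW (ltn_expl _ (prime_gt1 pp))) _; rewrite dvdn_leq ?pfactor_dvdnn.
apply: lerXn2r; rewrite ?nnegrE ?ler0n //; last exact: qe hk.
by rewrite exprn_ge0 // absval_ge0.
Qed.

(* For [|q| <= 1] the q-integers are integral, so only the denominators of the
   data matter. *)
Lemma qseq_integral (q : K) (m : nat) (b0 : K) (b x : 'I_m -> K) :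
  (forall k, q ^+ k.+1 != 1) ->
  exists2 D : nat, (0 < D)%N & forall (f : K -> R) N, is_absval f ->
    ultrametric_absval f -> f q <= 1 ->
    f (D%:R ^+ (2 * N ^ 2) * \det (hankel (qseq q b0 b x) N)) <= 1.
Proof.
move=> qX; set u := qseq q b0 b x.
have [D1 D10 h1] := integral_multiples b.
have [D2 D20 h2] := integral_multiples x.
have [D3 D30 h3] := integral_multiple (u 0).
have [D DE] : exists D, (D = D1 * D2 * D3)%N by exists (D1 * D2 * D3)%N.
exists D => [|f N af uf fq]; first by rewrite DE !muln_gt0 D10 D20.
have fD k : f (k%:R) <= 1 by exact: ultra_nat.
have hb i : f (D%:R * b i) <= 1.
  have -> : D%:R * b i = (D2 * D3)%:R * (D1%:R * b i) by rewrite DE !natrM; ring.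
  by rewrite absvalM // mulr_ile1 ?absval_ge0 // h1.
have hx i : f (D%:R * x i) <= 1.
  have -> : D%:R * x i = (D1 * D3)%:R * (D2%:R * x i) by rewrite DE !natrM; ring.
  by rewrite absvalM // mulr_ile1 ?absval_ge0 // h2.
have hu0 : f (D%:R * u 0%N) <= 1.
  have -> : D%:R * u 0%N = (D1 * D2)%:R * (D3%:R * u 0%N) by rewrite DE !natrM; ring.
  by rewrite absvalM // mulr_ile1 ?absval_ge0 // h3.
have q1 : 1 - q != 0 by rewrite subr_eq0 eq_sym; exact: (qX 0%N).
have hq n : f (qnum q n) <= 1.
  have -> : qnum q n = \sum_(i < n) q ^+ i.
    by apply: (mulIf q1); rewrite /qnum mulfVK // -opprB subrX1 -mulNr opprB mulrC.
  by apply: ultra_sum => // i _; rewrite absvalX // exprn_ile1 // absval_ge0.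
have hu n : f (D%:R ^+ n.+1 * u n) <= 1.
  elim: n => [|n IH]; first by rewrite expr1.
  rewrite /u qseq_rec // -/u mulrDr; apply: le_trans (uf _ _) _; rewrite ge_max.
  apply/andP; split.
    have -> : D%:R ^+ n.+2 * (qnum q n.+1 * u n) =
        D%:R * (qnum q n.+1 * (D%:R ^+ n.+1 * u n)) by rewrite exprS; ring.
    rewrite absvalM // mulr_ile1 ?absval_ge0 //.
    by rewrite absvalM // mulr_ile1 ?absval_ge0.
  rewrite mulr_sumr; apply: ultra_sum => // i _.
  have -> : D%:R ^+ n.+2 * (b i * x i ^+ n.+1) = D%:R * b i * (D%:R * x i) ^+ n.+1.
    by rewrite exprMn exprS; ring.
  by rewrite absvalM // absvalX // mulr_ile1 ?exprn_ge0 ?absval_ge0 // exprn_ile1 ?absval_ge0.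
(* One factor $D^{2N}$ per row covers the $D^{i+j+1}$ needed by each entry. *)
have -> : D%:R ^+ (2 * N ^ 2) * \det (hankel u N) = \det (D%:R ^+ (2 * N) *: hankel u N).
  by rewrite detZ -exprM -mulnn mulnA.
apply: ultra_det => // i j; rewrite !mxE.
have le : ((i + j).+1 <= 2 * N)%N by have := ltn_ord i; have := ltn_ord j; lia.
rewrite -(subnK le) exprD -mulrA absvalM // mulr_ile1 ?absval_ge0 ?hu //.
by rewrite -natrX fD.
Qed.

End Integrality.

(** Here the q-integers are bounded by $2/|1-q|$, so $u_n$ grows at most geometrically; conclude by
    the Leibniz expansion and $N! \le 2^{N^2}$. *)
Lemma qseq_small (K : fieldType) (R : realType) (q : K) (m : nat) (b0 : K)
  (b x : 'I_m -> K) (f : K -> R) : (forall k, q ^+ k.+1 != 1) ->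
  is_absval f -> f q < 1 ->
  exists C : R, 0 < C /\ forall N, f (\det (hankel (qseq q b0 b x) N)) <= C ^+ (N ^ 2).
Proof.
move=> qX af fq; set u := qseq q b0 b x.
have q1 : 1 - q != 0 by rewrite subr_eq0 eq_sym; exact: (qX 0%N).
pose B := 2 / f (1 - q).
pose C := 1 + B + \sum_i f (b i) + \sum_i f (x i) + f (u 0%N).
have B0 : 0 <= B by rewrite divr_ge0 ?(absval_ge0 af).
have sb0 : 0 <= \sum_i f (b i) by apply: sumr_ge0 => i _; apply: (absval_ge0 af).
have sx0 : 0 <= \sum_i f (x i) by apply: sumr_ge0 => i _; apply: (absval_ge0 af).
have u00 : 0 <= f (u 0%N) by apply: (absval_ge0 af).
have C1 : 1 <= C by rewrite /C; lra.
have C0 : 0 < C by rewrite (lt_le_trans ltr01).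
have xC i : f (x i) <= C.
  have : f (x i) <= \sum_i f (x i).
    by rewrite (bigD1 i) //= lerDl; apply: sumr_ge0 => j _; apply: (absval_ge0 af).
  by rewrite /C; lra.
have hq n : f (qnum q n) <= B.
  rewrite /qnum absvalM // absvalV // ler_pM ?invr_ge0 ?(absval_ge0 af) //.
  apply: le_trans (absvalB af _ _) _; rewrite absval1 // absvalX //.
  have : f q ^+ n <= 1 by rewrite exprn_ile1 ?(absval_ge0 af) // ltW.
  lra.
have hu n : f (u n) <= C ^+ n.+1.
  elim: n => [|n IH]; first by rewrite expr1 /C; lra.
  rewrite /u qseq_rec // -/u; apply: le_trans (absvalD af _ _) _.
  apply: (@le_trans _ _ (B * C ^+ n.+1 + (\sum_i f (b i)) * C ^+ n.+1)).
    apply: lerD; first by rewrite absvalM // ler_pM ?(absval_ge0 af).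
    apply: le_trans (absval_sum af _ _ _) _; rewrite mulr_suml; apply: ler_sum => i _.
    rewrite absvalM // absvalX // ler_wpM2l ?(absval_ge0 af) //.
    by apply: lerXn2r; rewrite ?nnegrE ?(absval_ge0 af) // ltW.
  rewrite -mulrDl [C ^+ n.+2]exprS ler_wpM2r //; first by rewrite exprn_ge0 // ltW.
  by rewrite /C; lra.
exists (2 * C ^+ 2); split => [|N]; first by rewrite mulr_gt0 // exprn_gt0.
apply: le_trans (@absval_det _ _ _ af N _ (fun=> C ^+ (2 * N)) _) _.
  move=> i j; rewrite mxE; apply: le_trans (hu _) _; rewrite ler_weXn2l //.
  by have := ltn_ord i; have := ltn_ord j; lia.
rewrite prodr_const card_ord exprMn -!exprM -mulnn mulnA ler_wpM2r //.
  by rewrite exprn_ge0 // ltW.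
rewrite -natrX ler_nat expnM; apply: leq_trans (_ : N ^ N <= _)%N; last first.
  by case: (N) => // k; rewrite leq_exp2r // ltnW // ltn_expl.
rewrite fact_prod; apply: leq_trans (_ : \prod_(1 <= i < N.+1) N <= _)%N.
  by rewrite !big_nat; apply: leq_prod => i /andP[_]; rewrite ltnS.
by rewrite prod_nat_const_nat subn1.
Qed.

(** * Vanishing of the Hankel determinants and its consequences *)

Local Open Scope classical_set_scope.

Theorem theorem4p5p1 (K : fieldExtType rat) (R : realType) (m : nat)
  (q xi beta0 : K) (alpha beta : 'I_m -> K) :
  q != 0 -> xi != 0 -> (forall i, alpha i != 0) ->
  (forall f : K -> R, is_absval f -> ~ ultrametric_absval f -> f q != 1) ->
  (forall (i j : 'I_m) (k : int), i != j -> alpha i != alpha j * q ^ k) ->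
  (forall f : K -> R, is_absval f -> 1 < f q ->
     (fun N : nat => f (beta0 + \sum_(i < m) beta i * Eq_partial q (alpha i * xi) N))
       @ \oo --> (0 : R)) ->
  beta0 = 0 /\
  (forall i : 'I_m, forall f : K -> R, is_absval f -> 1 < f q ->
     (fun N : nat => f (beta i * Eq_partial q (alpha i * xi) N)) @ \oo --> (0 : R)).
Proof.
move=> q0 xi0 alpha0 archq alphaq vanish.
have [s [sabs smallP]] := small_everywhere_eq0 K R.
have sa i : is_absval (s i) by case: (sabs i).
have sq1 i : s i q != 1 by case: (sabs i) => a u _; apply: archq.
have snat i (n : nat) : s i n%:R = n%:R by case: (sabs i).
have d0 : (0 < dim K)%N by have := adim_gt0 {:K}%AS; rewrite dimvf.
(* There is an archimedean place, and $|q| \ne 1$ there, so [q] is not a root of unity. *)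
have qX k : q ^+ k.+1 != 1.
  apply/eqP => /(congr1 (s (Ordinal d0))); rewrite absvalX // absval1 //.
  by move/eqP; rewrite pexpr_eq1 ?absval_ge0 // (negPf (sq1 _)).
(* Otherwise [q] itself would be small at every place, hence zero. *)
have [f0 [af0 f0q]] : exists f : K -> R, is_absval f /\ 1 < f q.
  apply: contrapT => no; move/eqP: q0; apply; apply: smallP => [f [af _ _]|i].
    by rewrite leNgt; apply/negP => gt; apply: no; exists f.
  by rewrite lt_neqAle sq1 leNgt; apply/negP => gt; apply: no; exists (s i).
pose x i := alpha i * xi.
have x0 i : x i != 0 by rewrite mulf_neq0.
have xq (i j : 'I_m) (k : int) : i != j -> x i != x j * q ^ k.
  move=> /(alphaq i j k); apply: contraNneq => e; apply/eqP/(mulIf xi0).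
  by rewrite -/(x i) e /x mulrAC.
pose u := qseq q beta0 beta x.
have c0 : (1 - q)^-1 != 0 by rewrite invr_eq0 subr_eq0 eq_sym; exact: (qX 0%N).
have rec := qseq_recE qX beta0 beta x.
have gain := recurrence_gain q0 c0 rec.
have small (F : set (K -> R)) : uniform_class q F -> forall M, exists N0,
    forall N f, (N0 <= N)%N -> F f -> f (\det (hankel u N)) * f q ^+ (M * N ^ 2) < 1.
  move=> uF M.
  have [|E hE] := qseq_uniform qX uF (b0 := beta0) (b := beta) (x := x).
    by move=> f Ff; case: uF => a b _ _; apply: vanish; [apply: a|apply: b].
  exact: (hankel_small uF hE gain M).
have [D D0 hD] := @qseq_integral K R q m beta0 beta x qX.
(* [M i] is chosen with $D^2 C |q|^{M_i} < 1$; raising this to the power $N^2$ gives the bound. *)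
have /choice[M hM] i : exists M : nat, s i q < 1 -> forall N, (0 < N)%N ->
    D%:R ^+ (2 * N ^ 2) * s i q ^+ (M * N ^ 2) * s i (\det (hankel u N)) < 1.
  case: (ltP (s i q) 1) => [lt|_]; last by exists 0%N.
  have [C [C0 hC]] := qseq_small beta0 beta x qX (sa i) lt.
  have sq : 0 < s i q by rewrite absval_gt0.
  have [|M hM] := @expr_unbounded R (s i q)^-1 (D%:R ^+ 2 * C); first by rewrite invf_gt1.
  exists M => _ N N0.
  have lt1 : D%:R ^+ 2 * C * s i q ^+ M < 1.
    by move: hM; rewrite exprVn -[_^-1]mul1r ltr_pdivlMr ?exprn_gt0.
  apply: (@le_lt_trans _ _ ((D%:R ^+ 2 * C * s i q ^+ M) ^+ (N ^ 2))).
    rewrite 2!exprMn -!exprM [X in _ <= X]mulrAC; apply: ler_wpM2l (hC N).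
    by rewrite mulr_ge0 ?exprn_ge0 ?ler0n // ltW.
  rewrite exprn_ilt1 // -?lt0n ?expn_gt0 ?N0 //.
  by rewrite !mulr_ge0 ?exprn_ge0 ?ler0n // ltW.
pose M0 := (\sum_i M i)%N.
(* The power of [D] gives integrality at p-adic places with $|q| \le 1$, the power of [q] gives
   smallness at embeddings with $|q| < 1$, and at the places used with $|q| > 1$ the decay of the
   determinant outweighs both. *)
pose y N := D%:R ^+ (2 * N ^ 2) * q ^+ (M0 * N ^ 2) * \det (hankel u N).
have D1 : 1 <= D%:R :> R by rewrite ler1n.
have e0 : (0 < (\dim {:K})`!)%N by rewrite fact_gt0.
have [N1 hN1] := small _ (padic_uniform R q e0) M0.
have /choice[N2 hN2] i : exists N2, forall N, (N2 <= N)%N -> s i (y N) < 1.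
  have yE N : s i (y N) = D%:R ^+ (2 * N ^ 2) * s i q ^+ (M0 * N ^ 2) *
      s i (\det (hankel u N)).
    by rewrite /y !(absvalM (sa i)) !(absvalX (sa i)) snat.
  case: (ltP (s i q) 1) => [lt|].
    exists 1%N => N N0; rewrite yE; apply: le_lt_trans (hM i lt N N0).
    rewrite ler_wpM2r ?absval_ge0 // ler_wpM2l ?exprn_ge0 ?ler0n //.
    rewrite ler_wiXn2l ?absval_ge0 ?(ltW lt) // leq_mul2r; apply/orP; right.
    by rewrite /M0 (bigD1 i) //= leq_addr.
  rewrite le_eqVlt eq_sym (negPf (sq1 i)) /= => gt.
  have uc := uniform_class1 (sa i) gt.
  (* At an embedding [D] is not small, so its power is absorbed through $D^2 < |q|^e$. *)
  have [e he] := expr_unbounded (D%:R ^+ 2) gt.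
  have [N2 h2] := small _ uc (M0 + e)%N.
  exists N2 => N le; rewrite yE; apply: le_lt_trans (h2 N (s i) le erefl).
  rewrite mulrC ler_wpM2l ?absval_ge0 // mulnDl exprD mulrC.
  rewrite ler_wpM2l ?exprn_ge0 ?absval_ge0 // exprM [X in _ <= X]exprM.
  by apply: lerXn2r; rewrite ?nnegrE ?exprn_ge0 ?ler0n ?absval_ge0 // ltW.
have det0 N : (N1 + \sum_i N2 i <= N)%N -> \det (hankel u N) = 0.
  move=> le; have /eqP : y N = 0.
    apply: smallP => [f pf|i]; last first.
      apply: hN2; apply: leq_trans le; rewrite (bigD1 i) //= addnCA.
      exact: leq_addr.
    have [af uf _] := pf; rewrite /y mulrAC absvalM //.
    case: (ltP 1 (f q)) => fq; last first.
      by rewrite mulr_ile1 ?absval_ge0 ?hD // absvalX // exprn_ile1 ?absval_ge0.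
    rewrite absvalM // -mulrA mulr_ile1 ?mulr_ge0 ?absval_ge0 //.
      by rewrite -natrX; exact: ultra_nat.
    rewrite absvalX //; apply/ltW/hN1 => //; exact: leq_trans (leq_addr _ _) le.
  rewrite /y !mulf_eq0 !expf_eq0 (negPf q0) andbF orbF fext_natr_eq0.
  by rewrite (gtn_eqF D0) andbF => /eqP.
have [r [r0 kr]] := kronecker det0.
have freq := frequencies_of_recurrent q0 c0 qX x0 xq rec r0 kr.
have conv i (f : K -> R) : is_absval f -> 1 < f q ->
    (fun N : nat => f (beta i * Eq_partial q (alpha i * xi) N)) @ \oo --> (0 : R).
  move=> af fq; have [b0|b0] := eqVneq (beta i) 0.
    under eq_fun => N do rewrite b0 mul0r absval0 //.
    exact: cvg_cst.
  have [t xt] := freq i b0.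
  have -> : (fun N : nat => f (beta i * Eq_partial q (alpha i * xi) N)) =
      (fun N => f (beta i) * f (Eq_partial q ((1 - q)^-1 * q ^+ t.+1) N)).
    by apply/funext => N; rewrite (absvalM af) -xt.
  rewrite -[X in (_ --> X)%classic](mulr0 (f (beta i))).
  by apply: cvgMr; apply: Eq_partial_cvg0.
split; last exact: conv.
(* At the place [f0], $|\beta_0|$ is at most the absolute value of the whole sum plus those of its
   terms, all tending to 0. *)
have lim : (fun N => f0 (beta0 + \sum_(i < m) beta i * Eq_partial q (alpha i * xi) N) +
    \sum_(i < m) f0 (beta i * Eq_partial q (alpha i * xi) N)) @ \oo --> (0 : R).
  rewrite -[X in _ --> X]addr0; apply: cvgD; first exact: vanish.
  have zs : \sum_(i < m) (0 : R) = 0 by rewrite big1.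
  rewrite -[X in (_ --> X)%classic]zs.
  by apply: cvg_big => [|i _]; [exact: add_continuous|exact: conv].
apply/eqP; rewrite -(absval_eq0 af0) eq_le absval_ge0 // andbT.
rewrite -(cvg_lim _ lim) //; apply: limr_ge; first by apply/cvg_ex; exists 0.
apply: nearW => N; rewrite -{1}[beta0](addrK (\sum_(i < m) beta i * Eq_partial q (alpha i * xi) N)).
by apply: le_trans (absvalB af0 _ _) _; rewrite lerD2l; exact: absval_sum.
Qed.
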